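(* Let $m\ge 1$, let $V$ be a complex vector space of dimension $d$, and let ${\rm Hilb}^{(m)}(V)=\bigcup_T S_T$ be the affine paving of the noncommutative Hilbert scheme by the subsets $S_T$ indexed by $d$-element trees $T\subset\Omega$. Then, for every $d$-element tree $T$, the intersection $S_T\cap{}^0{\rm Hilb}^{(m)}(V)$ with the punctual noncommutative Hilbert scheme is isomorphic to an affine space. Consequently, these intersections provide an affine paving of the variety ${}^0{\rm Hilb}^{(m)}(V)$.
   Context: Noncommutative Hilbert schemes: the group ${\rm GL}(V)$ acts on ${\rm End}(V)^m\times V$ by $g\cdot(\varphi_1,\ldots,\varphi_m,v)=(g\varphi_1g^{-1},\ldots,g\varphi_mg^{-1},gv)$. Write $\varphi_*=(\varphi_1,\ldots,\varphi_m)$. A point $(\varphi_*,v)$ is stable if $\mathbb{C}\langle\varphi_1,\ldots,\varphi_m\rangle\cdot v=V$. The open subset of stable points $({\rm End}(V)^m\times V)_{\rm st}$ admits a geometric quotient ${\rm Hilb}^{(m)}(V)=({\rm End}(V)^m\times V)_{\rm st}/{\rm GL}(V)$. Let $\mathcal{N}^{(m)}(V)\subset{\rm End}(V)^m$ be the closed subvariety of simultaneously nilpotent tuples, i.e. tuples for which there is a complete flag $0=F_0\subset F_1\subset\ldots\subset F_d=V$ with $\varphi_k(F_i)\subset F_{i-1}$ for all $k,i$. The punctual noncommutative Hilbert scheme ${}^0{\rm Hilb}^{(m)}(V)\subset{\rm Hilb}^{(m)}(V)$ is the closed subvariety of classes of stable $(\varphi_*,v)$ with $\varphi_*\in\mathcal{N}^{(m)}(V)$;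 equivalently, it is the fibre over $0$ of the projective morphism ${\rm Hilb}^{(m)}(V)\to{\rm End}(V)^m//{\rm GL}(V)$ forgetting $v$. Trees: let $\Omega$ be the set of finite words (including the empty word $\emptyset$) in the alphabet $\{1,\ldots,m\}$, totally ordered by the lexicographic order $<_{\rm lex}$ induced by $1<2<\ldots<m$ (a proper left subword of a word is smaller than the word). A subset $T\subset\Omega$ is called a tree if it is closed under taking left subwords (prefixes). The sets $S_T$: for a $d$-element tree $T$, choose a basis $(e_\omega)_{\omega\in T}$ of $V$ indexed by the words in $T$. Let $\widetilde{S}_T\subset{\rm End}(V)^m\times V$ be the set of tuples $(\varphi_*,v)$ such that: (i) $v=e_\emptyset$; (ii) $\varphi_k(e_\omega)=e_{\omega k}$ whenever $\omega,\omega k\in T$; (iii) $\varphi_k(e_\omega)\in\langle e_{\omega'} : \omega'\in T,\ \omega'<_{\rm lex}\omega k\rangle$ whenever $\omega\in T$, $\omega k\notin T$. Let $S_T\subset{\rm Hilb}^{(m)}(V)$ be the image of $\widetilde{S}_T$ under the quotient map. It is a known fact that the $S_T$, for $T$ ranging over the $d$-element trees, form an affine paving of ${\rm Hilb}^{(m)}(V)$. An affine paving of a variety $X$ is a finite decomposition of $X$ into locally closed subvarieties, each isomorphic to an affine space, which can be ordered such that the union of each initial segment of pieces is closed in $X$. *)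

(* Defs.v *)
From HB Require Import structures.
From mathcomp Require Import all_boot all_order all_algebra finmap.
From mathcomp Require Import boolp classical_sets functions reals.
From mathcomp Require Import topology_structure quotient_topology.
From mathcomp Require Import initial_topology subtype_topology.
From mathcomp Require Import complex mpoly.

Set Implicit Arguments.
Unset Strict Implicit.
Unset Printing Implicit Defensive.

Import Order.TTheory GRing.Theory.
Local Open Scope classical_set_scope.
Local Open Scope ring_scope.

#[local] Obligation Tactic := idtac.

(* Varieties are handled as "spaces with functions": a topological space       *)
(* together with a sheaf of K-algebras of K-valued functions.  Over an         *)
(* algebraically closed field, reduced varieties form a full subcategory of    *)
(* these.  A function on U is represented by a function on the whole space     *)
(* whose values outside U are irrelevant; [regular U] is meaningful for open U *)
(* only.                                                                       *)
Record fspace (K : fieldType) := FSpace {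
  fsort :> topologicalType;
  regular : set fsort -> (fsort -> K) -> Prop;
  regular_ext : forall U f g,
    (forall x, U x -> f x = g x) -> regular U f -> regular U g;
  regular_res : forall U V f,
    open U -> open V -> V `<=` U -> regular U f -> regular V f;
  regular_glue : forall U f, open U ->
    (forall x, U x -> exists N, [/\ open N, N x, N `<=` U & regular N f]) ->
    regular U f;
  regular_cst : forall U (c : K), open U -> regular U (fun=> c);
  regularD : forall U f g, open U ->
    regular U f -> regular U g -> regular U (fun x => f x + g x);
  regularM : forall U f g, open U ->
    regular U f -> regular U g -> regular U (fun x => f x * g x) }.

Definition is_morphism (K : fieldType) (X Y : fspace K) (F : X -> Y) : Prop :=
  continuous F /\
  forall (V : set Y) (h : Y -> K),
    open V -> regular V h -> regular (F @^-1` V) (h \o F).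

Definition isomorphic (K : fieldType) (X Y : fspace K) : Prop :=
  exists (F : X -> Y) (G : Y -> X),
    [/\ cancel F G, cancel G F, is_morphism F & is_morphism G].

Section AffineSpace.
Variables (K : fieldType) (W : vectType K).

Definition zariski : Type := W.
HB.instance Definition _ := Choice.on zariski.

Definition poly_fun (p : {mpoly K[\dim {:W}]}) (w : W) : K :=
  p.@[fun i => coord (vbasis {:W}) i w].

Definition zariski_open (U : set zariski) : Prop :=
  exists P : set {mpoly K[\dim {:W}]},
    U = [set w | exists2 p, P p & poly_fun p w != 0].

Fact zariski_openT : zariski_open setT.
Proof.
exists setT; apply/seteqP; split=> // w _; exists 1 => //.
by rewrite /poly_fun meval1 oner_eq0.
Qed.

Fact zariski_openI : setI_closed zariski_open.
Proof.
move=> _ _ [P ->] [Q ->].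
exists [set r | exists p q, [/\ P p, Q q & r = p * q]].
apply/seteqP; split=> w /=.
- move=> [[p Pp p0] [q Qq q0]]; exists (p * q); first by exists p, q.
  by rewrite /poly_fun mevalM mulf_neq0.
- move=> [_ [p [q [Pp Qq ->]]]].
  rewrite /poly_fun mevalM mulf_eq0 negb_or => /andP[p0 q0].
  by split; [exists p|exists q].
Qed.

Fact zariski_open_bigU (I : Type) (f : I -> set zariski) :
  (forall i, zariski_open (f i)) -> zariski_open (\bigcup_i f i).
Proof.
move=> fo; exists [set p | exists i, forall w, poly_fun p w != 0 -> f i w].
apply/seteqP; split=> w /=.
- move=> [i _]; have [P fE] := fo i; rewrite fE => -[p Pp p0].
  by exists p => //; exists i => w' p0'; rewrite fE; exists p.
- by move=> [p [i pf] p0]; exists i => //; apply: pf.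
Qed.

HB.instance Definition _ := isOpenTopological.Build zariski
  zariski_openT zariski_openI zariski_open_bigU.

Definition affine_regular (U : set zariski) (f : zariski -> K) : Prop :=
  forall x, U x -> exists (N : set zariski) (g h : {mpoly K[\dim {:W}]}),
    [/\ open N, N x, N `<=` U &
        forall y, N y -> poly_fun h y != 0 /\ f y = poly_fun g y / poly_fun h y].

Program Definition affine : fspace K :=
  @FSpace K zariski affine_regular _ _ _ _ _ _.
Next Obligation.
move=> U f g fg fr x Ux; have [N [p [q [oN Nx NU fE]]]] := fr x Ux.
exists N, p, q; split=> // y Ny; have [q0 fy] := fE y Ny.
by rewrite -fg //; exact: NU.
Qed.
Next Obligation.
move=> U V f oU oV VU fr x Vx; have [N [p [q [oN Nx NU fE]]]] := fr x (VU x Vx).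
exists (N `&` V), p, q; split=> //; first exact: openI.
by move=> y [Ny _]; exact: fE.
Qed.
Next Obligation.
move=> U f oU fr x Ux; have [N [oN Nx NU Nr]] := fr x Ux.
have [M [p [q [oM Mx MN fE]]]] := Nr x Nx.
by exists M, p, q; split=> //; exact: subset_trans NU.
Qed.
Next Obligation.
move=> U c oU x Ux; exists U, c%:MP, 1; split=> // y _.
by rewrite /poly_fun meval1 mevalC oner_eq0 divr1.
Qed.
Next Obligation.
move=> U f g oU fr gr x Ux.
have [N [p [q [oN Nx NU fE]]]] := fr x Ux.
have [M [r [s [oM Mx MU gE]]]] := gr x Ux.
exists (N `&` M), (p * s + r * q), (q * s); split=> //; first exact: openI.
  by move=> y [/NU].
move=> y [Ny My]; have [q0 ->] := fE y Ny; have [s0 ->] := gE y My.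
rewrite /poly_fun in q0 s0 *.
by rewrite mevalD !mevalM mulf_neq0 // addf_div.
Qed.
Next Obligation.
move=> U f g oU fr gr x Ux.
have [N [p [q [oN Nx NU fE]]]] := fr x Ux.
have [M [r [s [oM Mx MU gE]]]] := gr x Ux.
exists (N `&` M), (p * r), (q * s); split=> //; first exact: openI.
  by move=> y [/NU].
move=> y [Ny My]; have [q0 ->] := fE y Ny; have [s0 ->] := gE y My.
rewrite /poly_fun in q0 s0 *.
by rewrite !mevalM mulf_neq0 // mulf_div.
Qed.

End AffineSpace.

Definition is_affine_space (K : fieldType) (X : fspace K) : Prop :=
  exists n : nat, isomorphic X (affine 'rV[K]_n).

(* The induced (reduced) structure on a subset: regular functions are those   *)
(* that extend locally to regular functions on the ambient space.             *)
Section Subspace.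
Variables (K : fieldType) (X : fspace K) (Z : set X).

Definition sub_regular (U : set Z) (f : Z -> K) : Prop :=
  forall x : Z, U x -> exists (N : set X) (g : X -> K),
    [/\ open N, N (val x), regular N g &
        forall y : Z, N (val y) -> U y /\ f y = g (val y)].

Program Definition subvariety : fspace K :=
  @FSpace K (Z : Type) sub_regular _ _ _ _ _ _.
Next Obligation.
move=> U f g fg fr x Ux; have [N [h [oN Nx hr fE]]] := fr x Ux.
by exists N, h; split=> // y /fE[Uy fy]; split=> //; rewrite -fg.
Qed.
Next Obligation.
move=> U V f _ [M oM MV] VU fr x Vx.
have [N [h [oN Nx hr fE]]] := fr x (VU x Vx).
exists (N `&` M), h; split.
- exact: openI.
- by split=> //; rewrite -MV in Vx.
- by apply: regular_res hr => //; exact: openI.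
- by move=> y [Ny My]; rewrite -MV; split=> //; have [] := fE y Ny.
Qed.
Next Obligation.
move=> U f oU fr x Ux; have [M [oM Mx MU Mr]] := fr x Ux.
have [N [h [oN Nx hr fE]]] := Mr x Mx.
by exists N, h; split=> // y /fE[My fy]; split=> //; exact: MU.
Qed.
Next Obligation.
move=> U c [N oN NU] x Ux; exists N, (fun=> c); split=> //.
- by rewrite -NU in Ux.
- exact: regular_cst.
- by move=> y Ny; rewrite -NU.
Qed.
Next Obligation.
move=> U f g oU fr gr x Ux.
have [N [p [oN Nx pr fE]]] := fr x Ux.
have [M [q [oM Mx qr gE]]] := gr x Ux.
have oNM : open (N `&` M) by exact: openI.
exists (N `&` M), (fun y => p y + q y); split=> //.
  by apply: regularD => //;
    [apply: regular_res pr|apply: regular_res qr] => // y [].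
by move=> y [/fE[Uy ->] /gE[_ ->]].
Qed.
Next Obligation.
move=> U f g oU fr gr x Ux.
have [N [p [oN Nx pr fE]]] := fr x Ux.
have [M [q [oM Mx qr gE]]] := gr x Ux.
have oNM : open (N `&` M) by exact: openI.
exists (N `&` M), (fun y => p y * q y); split=> //.
  by apply: regularM => //;
    [apply: regular_res pr|apply: regular_res qr] => // y [].
by move=> y [/fE[Uy ->] /gE[_ ->]].
Qed.

End Subspace.

(* For the orbit relation of a group action this is the geometric quotient:   *)
(* quotient topology, and the sheaf of invariant functions.                   *)
Section QuotientSpace.
Variables (K : fieldType) (X : fspace K) (Q : quotType X).

Let QX : topologicalType := quotient_topology Q.
Let proj : X -> QX := \pi_(quotient_topology Q)%qT.

Let proj_open (U : set QX) : open U -> open (proj @^-1` U).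
Proof. by move: U; apply/continuousP; exact: pi_continuous. Qed.

Definition quot_regular (U : set QX) (f : QX -> K) : Prop :=
  regular (proj @^-1` U) (f \o proj).

Program Definition quotient_space : fspace K :=
  @FSpace K QX quot_regular _ _ _ _ _ _.
Next Obligation. by move=> U f g fg; apply: regular_ext => x /fg. Qed.
Next Obligation.
move=> U V f oU oV VU; apply: regular_res; try exact: proj_open.
by move=> x; exact: VU.
Qed.
Next Obligation.
move=> U f oU fr; apply: regular_glue; first exact: proj_open.
move=> x Ux; have [N [oN Nx NU Nr]] := fr _ Ux.
by exists (proj @^-1` N); split=> // y; exact: NU.
Qed.
Next Obligation. by move=> U c oU; apply/regular_cst/proj_open. Qed.
Next Obligation.
by move=> U f g oU fr gr; exact: (regularD (proj_open oU) fr gr).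
Qed.
Next Obligation.
by move=> U f g oU fr gr; exact: (regularM (proj_open oU) fr gr).
Qed.

Definition quot_proj : X -> quotient_space := proj.

End QuotientSpace.

Definition locally_closed (X : topologicalType) (A : set X) : Prop :=
  exists U F : set X, [/\ open U, closed F & A = U `&` F].

Definition is_affine_paving (K : fieldType) (X : fspace K) (I : eqType)
    (D : set I) (S : I -> set X) : Prop :=
  [/\ \bigcup_(i in D) S i = setT,
      trivIset D S,
      forall i, D i -> locally_closed (S i) /\ is_affine_space (subvariety (S i))
    & exists s : seq I, [/\ uniq s, [set` s] = D &
        forall k : nat, closed (\bigcup_(i in [set` take k s]) S i)]].

Notation word m := (seq 'I_m).

Definition lexlt (m : nat) (w w' : word m) : bool :=
  (w < w' :> seqlexi 'I_m)%O.

Definition is_tree (m : nat) (T : {fset word m}) : Prop :=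
  forall u w : word m, prefix u w -> w \in T -> u \in T.

Definition trees (m d : nat) : set {fset word m} :=
  [set T | is_tree T /\ #|` T| = d].
Arguments trees : clear implicits.

Section Hilb.
Variables (K : fieldType) (m : nat) (V : vectType K).

(* The vector space End(V)^m x V. *)
Definition pairs : vectType K := ({ffun 'I_m -> 'End(V)} * V)%type.

Definition is_subalgebra (A : set 'End(V)) : Prop :=
  [/\ A \1%VF,
      forall (a : K) f g, A f -> A g -> A (a *: f + g) &
      forall f g, A f -> A g -> A (f \o g)%VF].

Definition generated_algebra (phi : {ffun 'I_m -> 'End(V)}) : set 'End(V) :=
  smallest is_subalgebra (range phi).

Definition stable : set (affine pairs) :=
  [set x : pairs |
    [set (f : 'End(V)) x.2 | f in generated_algebra x.1] = setT].

Definition gl_act (g : 'End(V)) (x : pairs) : pairs :=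
  ([ffun k => (g \o x.1 k \o g^-1)%VF], g x.2).

Definition same_orbit (x y : subvariety stable) : bool :=
  `[< exists g : 'End(V), bijective g /\ val y = gl_act g (val x) >].

Fact same_orbit_refl : reflexive same_orbit.
Proof.
move=> x; apply/asboolP; exists \1%VF; split.
  by exists id => v; rewrite id_lfunE.
case: (val x) => phi v; congr pair; last by rewrite /= id_lfunE.
have inv1 : (\1^-1 = \1 :> 'End(V))%VF.
  by rewrite -[LHS]comp_lfun1l -[LHS]comp_lfun1r inv_lfun_def.
by apply/ffunP=> k; rewrite ffunE inv1 comp_lfun1l comp_lfun1r.
Qed.

Fact same_orbit_sym : ssrbool.symmetric same_orbit.
Proof.
suff sym x y : same_orbit x y -> same_orbit y x.
  by move=> x y; apply/idP/idP; exact: sym.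
move=> /asboolP[g [gbij yE]]; apply/asboolP.
have gK : lker g == 0%VS by apply/lker0P; exact: bij_inj.
have ginvK : lker (g^-1)%VF == 0%VS.
  by apply/lker0P; exact: can_inj (lker0_lfunVK gK).
exists (g^-1)%VF; split.
  by exists g; [exact: lker0_lfunVK|exact: lker0_lfunK].
have gVV : (g^-1^-1)%VF = g.
  by rewrite -[LHS]comp_lfun1l -(lker0_compfV gK) lker0_compfK.
rewrite yE; case: (val x) => phi v; congr pair; last by rewrite /= lker0_lfunK.
by apply/ffunP=> k; rewrite !ffunE /= gVV -comp_lfunA lker0_compfVK // lker0_compKf.
Qed.

Fact same_orbit_trans : transitive same_orbit.
Proof.
move=> y x z /asboolP[g [gb yE]] /asboolP[h [hb zE]]; apply/asboolP.
have gK : lker g == 0%VS by apply/lker0P; exact: bij_inj.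
have hK : lker h == 0%VS by apply/lker0P; exact: bij_inj.
have hgb : bijective (h \o g)%VF.
  by apply: (eq_bij (bij_comp hb gb)) => v; rewrite comp_lfunE.
have hgK : lker (h \o g)%VF == 0%VS by apply/lker0P; exact: bij_inj.
exists (h \o g)%VF; split=> //; rewrite zE yE.
have VE : ((h \o g)^-1 = g^-1 \o h^-1)%VF.
  apply/lfunP=> v; apply: (lker0P hgK).
  by rewrite lker0_lfunVK // !comp_lfunE !lker0_lfunVK.
case: (val x) => phi v; congr pair; last by rewrite /= comp_lfunE.
by apply/ffunP=> k; rewrite !ffunE /= VE !comp_lfunA.
Qed.

Canonical same_orbit_equiv :=
  EquivRel same_orbit same_orbit_refl same_orbit_sym same_orbit_trans.

Definition hilb : fspace K :=
  quotient_space {eq_quot same_orbit_equiv}%qT.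

Definition hilb_class (x : subvariety stable) : hilb :=
  quot_proj {eq_quot same_orbit_equiv}%qT x.

Definition sim_nilpotent (phi : {ffun 'I_m -> 'End(V)}) : Prop :=
  exists F : nat -> {vspace V},
    [/\ forall i, (i <= \dim {:V})%N -> \dim (F i) = i,
        forall i, (i < \dim {:V})%N -> (F i <= F i.+1)%VS &
        forall k i, (i < \dim {:V})%N -> (phi k @: F i.+1 <= F i)%VS].

Definition punctual_hilb : set hilb :=
  [set hilb_class x | x in [set x : subvariety stable | sim_nilpotent (val x).1]].

Definition cell_lift (T : {fset word m}) (e : word m -> V) : set pairs :=
  [set x : pairs |
    [/\ x.2 = e [::],
        forall w k, w \in T -> rcons w k \in T -> x.1 k (e w) = e (rcons w k) &
        forall w k, w \in T -> rcons w k \notin T ->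
          x.1 k (e w) \in <<[seq e w' | w' <- T & lexlt w' (rcons w k)]>>%VS]].

(* All points of [cell_lift T e] are stable when [e] enumerates a basis of V   *)
(* along the tree T, so nothing is lost by restricting to stable points.      *)
Definition cell (T : {fset word m}) (e : word m -> V) : set hilb :=
  [set hilb_class x | x in [set x : subvariety stable | cell_lift T e (val x)]].

End Hilb.

Arguments pairs : clear implicits.
Arguments stable : clear implicits.
Arguments hilb : clear implicits.
Arguments punctual_hilb : clear implicits.

(* Main.v *)
Require Import Defs.
From HB Require Import structures.
From mathcomp Require Import all_boot all_order all_algebra finmap.
From mathcomp Require Import boolp classical_sets functions reals.
From mathcomp Require Import topology_structure quotient_topology.
From mathcomp Require Import initial_topology subtype_topology.
From mathcomp Require Import complex mpoly.

Set Implicit Arguments.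
Unset Strict Implicit.
Unset Printing Implicit Defensive.

Import Order.TTheory GRing.Theory.
Local Open Scope classical_set_scope.
Local Open Scope ring_scope.

(** Write [v_w] for the image of the distinguished vector under the letters of the
    word [w], applied from left to right. A tree [T] with as many words as the
    dimension frames a stable point if the vectors [v_w], for [w] in [T], form a
    basis; this is an open, invariant condition.

    Depth-first search in lexicographic order attaches to a stable point the least
    tree framing it, where trees are compared through their sorted lists of words
    ([staircase_key_le], [depth_first_tree]), and the cell of [T] consists of the
    points whose least tree is [T] ([cellP], [cellE]). Hence a cell is an open set
    minus the open sets of the smaller trees, and listing the trees in decreasing
    order makes the unions of initial segments closed ([cell_segment_closed]).

    On the cell of [T] each [v_{wk}] with [w] in [T] and [wk] outside [T] is a
    combination of the [v_u] with [u] in [T] and [u < wk]. Such a [u] either is a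
    prefix of [w], or comes after [w] in the order of words over the reversed
    alphabet. If no prefix of [w] occurs, the operators are simultaneously strictly
    triangular for that order, hence simultaneously nilpotent ([strict_nilpotent]).
    Conversely, nilpotency makes the coefficients at prefixes of [w] vanish
    ([nilpotent_strict]): modulo the invariant subspace spanned by the words that
    branch off below a given prefix [p], the vector [v_p] generates the span of its
    descendants, and a generator of a nonzero nilpotent module is not in the
    radical. So the punctual part of a cell is cut out by the vanishing of some of
    the coefficients.

    In the orbit of a point of the cell there is exactly one tuple for which the
    [v_w] are the prescribed basis, and the remaining coefficients of this tuple
    are free parameters. They are regular functions by Cramer's rule, and the tuple
    depends on them in an affine linear way, so the punctual part of the cell is an
    affine space ([cell_punctual_affine]). *)

(** * Spaces with functions *)
Section SpacesWithFunctions.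
Variable K : fieldType.
Implicit Types X Y Z : fspace K.

Lemma morphism_comp X Y Z (F : X -> Y) (G : Y -> Z) :
  is_morphism F -> is_morphism G -> is_morphism (G \o F).
Proof.
move=> [cF rF] [cG rG]; split; first by move=> x; exact: continuous_comp (cF x) (cG _).
by move=> V h oV hV; apply: (rF (G @^-1` V) (h \o G));
  [move/continuousP: cG; apply|exact: rG].
Qed.

Lemma isomorphic_trans X Y Z :
  isomorphic X Y -> isomorphic Y Z -> isomorphic X Z.
Proof.
move=> [F [F' [FK F'K mF mF']]] [G [G' [GK G'K mG mG']]].
exists (G \o F), (F' \o G'); split.
- exact: can_comp.
- exact: can_comp.
- exact: morphism_comp.
- exact: morphism_comp.
Qed.

Lemma open_subvariety X (A : set X) (N : set X) :
  open N -> open (val @^-1` N : set (subvariety A)).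
Proof. by move=> oN; exists N. Qed.

Lemma subvariety_val_morphism X (A : set X) :
  is_morphism (val : subvariety A -> X).
Proof.
split; first by apply/continuousP => N; exact: open_subvariety.
by move=> V h oV hV x Vx; exists V, h; split.
Qed.

(** The induced structure has the universal property of a subobject: regularity
    on [A] is extendability to [X] locally, and extensions pull back along
    [val \o F]. All maps into strata and into the punctual locus are handled
    through this lemma. *)
Lemma subvariety_morphism X Y (A : set X) (F : Y -> subvariety A) :
  is_morphism (val \o F : Y -> X) -> is_morphism F.
Proof.
move=> [cF rF]; have {}cF : continuous F.
  by apply/continuousP => _ [N oN <-]; move/continuousP: cF; exact.
split=> // V h oV hV; apply: regular_glue.
  by move/continuousP: cF; exact.
move=> y Vy; have [N [g [oN Ny gN NE]]] := hV (F y) Vy.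
exists ((val \o F) @^-1` N); split=> //.
- by move/continuousP: cF => /(_ _ (open_subvariety A oN)).
- by move=> z /= /NE[].
- by apply: regular_ext (rF _ _ oN gN) => z /= /NE[].
Qed.

(** A cell cut out inside the punctual locus and the same cell viewed directly in
    the ambient space carry the same structure; this reduces the pieces of the
    paving to the intersections in the Hilbert scheme. *)
Lemma subvariety_preimage_isomorphic X (P C : set X) :
  isomorphic (@subvariety K (subvariety P) (val @^-1` C))
             (subvariety (C `&` P)).
Proof.
have CP (q : @subvariety K (subvariety P) (val @^-1` C)) :
    (val (val q) : X) \in C `&` P.
  by apply: mem_set; split; [exact: set_mem (valP q)|exact: set_mem (valP (val q))].
have PC (q : subvariety (C `&` P)) : (val q : X) \in P.
  by apply: mem_set; have [] := set_mem (valP q).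
have PCC q : (exist _ (val q) (PC q) : subvariety P) \in val @^-1` C.
  by apply: mem_set; have [] := set_mem (valP q).
pose F q : subvariety (C `&` P) := exist _ (val (val q)) (CP q).
pose G q : @subvariety K (subvariety P) (val @^-1` C) :=
  exist _ (exist _ (val q) (PC q) : subvariety P) (PCC q).
exists F, G; split.
- by move=> q; apply: val_inj; apply: val_inj.
- by move=> q; apply: val_inj.
- apply: subvariety_morphism.
  exact: morphism_comp (@subvariety_val_morphism _ _) (@subvariety_val_morphism _ _).
- do 2!apply: subvariety_morphism; exact: subvariety_val_morphism.
Qed.

Lemma quot_proj_morphism X (Q : quotType X) : is_morphism (quot_proj Q).
Proof. by split; [exact: pi_continuous|]. Qed.

Lemma regular_sum X (U : set X) (I : Type) (r : seq I) (P : pred I)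
    (f : I -> X -> K) :
  open U -> (forall i, P i -> regular U (f i)) ->
  regular U (fun x => \sum_(i <- r | P i) f i x).
Proof.
move=> oU fU; elim: r => [|i r IHr].
  by apply: regular_ext (regular_cst 0 oU) => x _; rewrite big_nil.
case Pi: (P i); last by apply: regular_ext IHr => x _; rewrite big_cons Pi.
by apply: regular_ext (regularD oU (fU i Pi) IHr) => x _; rewrite big_cons Pi.
Qed.

Lemma regular_prod X (U : set X) (I : Type) (r : seq I) (P : pred I)
    (f : I -> X -> K) :
  open U -> (forall i, P i -> regular U (f i)) ->
  regular U (fun x => \prod_(i <- r | P i) f i x).
Proof.
move=> oU fU; elim: r => [|i r IHr].
  by apply: regular_ext (regular_cst 1 oU) => x _; rewrite big_nil.
case Pi: (P i); last by apply: regular_ext IHr => x _; rewrite big_cons Pi.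
by apply: regular_ext (regularM oU (fU i Pi) IHr) => x _; rewrite big_cons Pi.
Qed.

Lemma regular_det X (U : set X) n (A : X -> 'M[K]_n) :
  open U -> (forall i j, regular U (fun x => A x i j)) ->
  regular U (fun x => \det (A x)).
Proof.
move=> oU AU; apply: regular_sum => // s _; apply: regularM => //.
  exact: regular_cst.
by apply: regular_prod => // i _; exact: AU.
Qed.

Lemma regular_adj X (U : set X) n (A : X -> 'M[K]_n) i j :
  open U -> (forall i j, regular U (fun x => A x i j)) ->
  regular U (fun x => (\adj (A x)) i j).
Proof.
move=> oU AU; have : regular U (fun x => cofactor (A x) j i).
  apply: regularM => //; first exact: regular_cst.
  apply: regular_det => // k l.
  by apply: regular_ext (AU (lift j k) (lift i l)) => x _; rewrite !mxE.
by apply: regular_ext => x _; rewrite mxE.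
Qed.

(** A space with functions is only required to have sheaves of algebras. Being
    locally ringed, in the sense that a regular function may be inverted where it
    does not vanish, is a separate property; it is what makes a map to affine space
    with regular coordinates a morphism. *)
Definition has_inverses X : Prop := forall (U : set X) (f : X -> K),
  open U -> regular U f ->
  open (U `&` [set x | f x != 0]) /\
  regular (U `&` [set x | f x != 0]) (fun x => (f x)^-1).

Lemma affine_has_inverses (W : vectType K) : has_inverses (affine W).
Proof.
move=> U f oU fU.
have loc (x : affine W) : (U `&` [set x | f x != 0]) x ->
    exists (N : set (affine W)) (g h : {mpoly K[\dim {:W}]}),
    [/\ open N, N x, N `<=` U `&` [set x | f x != 0] &
        forall y, N y -> poly_fun h y != 0 /\ (f y)^-1 = poly_fun g y / poly_fun h y].
  move=> [Ux fx]; have [N [g [h [oN Nx NU fE]]]] := fU x Ux.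
  exists (N `&` [set y | poly_fun g y != 0]), h, g; split.
  - apply: openI => //; exists [set g]; apply/seteqP; split=> y /=.
      by exists g.
    by move=> [_ ->].
  - split=> //=; have [h0 fxE] := fE x Nx.
    by move: fx; rewrite /= fxE mulf_eq0 negb_or => /andP[].
  - move=> y [Ny gy]; split; first exact: NU.
    by have [h0 /= ->] := fE y Ny; rewrite mulf_neq0 // invr_neq0.
  - by move=> y [Ny gy]; have [h0 ->] := fE y Ny; rewrite invf_div.
split=> //; rewrite openE => x /loc[N [g [h [oN Nx NU _]]]].
by rewrite /interior nbhsE; exists N.
Qed.

Lemma subvariety_has_inverses X (A : set X) :
  has_inverses X -> has_inverses (subvariety A).
Proof.
move=> invX U f oU fU.
have loc (x : subvariety A) : (U `&` [set x | f x != 0]) x ->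
    exists (N : set X) (g : X -> K),
    [/\ open N, N (val x), regular N g &
        forall y : subvariety A, N (val y) ->
          (U `&` [set x | f x != 0]) y /\ (f y)^-1 = g (val y)].
  move=> [Ux fx]; have [N [g [oN Nx gN fE]]] := fU x Ux.
  have [oM rM] := invX _ _ oN gN; exists (N `&` [set y | g y != 0]), (fun y => (g y)^-1).
  split=> //; first by split=> //=; have [_ <-] := fE x Nx.
  by move=> y [/fE[Uy fy]] /= gy; rewrite -fy in gy *.
split=> //; rewrite openE => x /loc[N [g [oN Nx gN NE]]].
rewrite /interior nbhsE; exists (val @^-1` N).
  by split=> //; exact: open_subvariety.
by move=> y /= /NE[].
Qed.

Lemma quotient_has_inverses X (Q : quotType X) :
  has_inverses X -> has_inverses (quotient_space Q).
Proof.
move=> invX U f oU fU.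
have /continuousP/(_ U oU) oU' := (quot_proj_morphism Q).1.
by have [? ?] := invX _ _ oU' fU; split.
Qed.

End SpacesWithFunctions.

(** * Morphisms to affine space *)
Section MapsToAffineSpace.
Variable K : fieldType.
Implicit Types X Y : fspace K.

Lemma regular_poly_fun X (W : vectType K) (U : set X) (F : X -> affine W)
    (p : {mpoly K[\dim {:W}]}) :
  open U -> (forall i, regular U (fun x => coord (vbasis {:W}) i (F x))) ->
  regular U (fun x => poly_fun p (F x)).
Proof.
move=> oU FU.
apply: (@regular_ext _ _ _ (fun x => \sum_(a <- msupp p) p@_a *
    \prod_i \prod_(j < a i) coord (vbasis {:W}) i (F x))).
  move=> x _; rewrite /poly_fun mevalE; apply: eq_bigr => a _; congr (_ * _).
  by apply: eq_bigr => i _; rewrite prodr_const card_ord.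
apply: regular_sum => // a _; apply: regularM => //; first exact: regular_cst.
by apply: regular_prod => // i _; apply: regular_prod.
Qed.

(** Continuity holds because basic open sets pull back to non-vanishing loci of
    regular functions, and a local fraction of polynomials pulls back to a fraction
    of regular functions whose denominator does not vanish. *)
Lemma affine_morphism X (W : vectType K) (F : X -> affine W) :
  has_inverses X ->
  (forall i, regular setT (fun x => coord (vbasis {:W}) i (F x))) ->
  is_morphism F.
Proof.
move=> invX FT.
have oT : open (setT : set X) by exact: openT.
have pT p : regular setT (fun x => poly_fun p (F x)) by exact: regular_poly_fun.
have cF : continuous F.
  apply/continuousP => _ [P ->].
  rewrite (_ : _ @^-1` _ = \bigcup_(p in P) [set x | poly_fun p (F x) != 0]).
    apply: bigcup_open => p _.
    by have [+ _] := invX _ _ oT (pT p); rewrite setTI.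
  by apply/seteqP; split=> x /= [p Pp px]; exists p.
split=> // V h oV hV.
have /continuousP cF' := cF.
apply: regular_glue; first exact: cF'.
move=> x /hV[N [g [q [oN Nx NV hE]]]]; exists (F @^-1` N); split=> //.
- exact: cF'.
- by move=> y; exact: NV.
have oFN : open (F @^-1` N) by exact: cF'.
have rN p : regular (F @^-1` N) (fun x => poly_fun p (F x)).
  by apply: regular_res (pT p).
have [_ rq] := invX _ _ oFN (rN q).
apply: (@regular_ext _ _ _ (fun y => poly_fun g (F y) * (poly_fun q (F y))^-1)).
  by move=> y /hE[_ hy]; rewrite /= hy.
apply: regularM => //.
rewrite (_ : F @^-1` N = F @^-1` N `&` [set y | poly_fun q (F y) != 0]) //.
by apply/seteqP; split=> [y Ny|y []//]; split=> //; have [] := hE _ Ny.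
Qed.

(** Regularity on an affine space refers to coordinates in [vbasis]; this lemma
    makes every linear form regular, so that other bases may be used freely. *)
Lemma regular_scalar (W : vectType K) (U : set (affine W)) (l : W -> K) :
  open U -> scalar l -> @regular K (affine W) U l.
Proof.
move=> oU ll; pose lL := GRing.isLinear.Build K W K *%R l ll.
pose l' : {scalar W} := HB.pack l lL.
apply: (@regular_ext K (affine W) U
  (fun w => \sum_i coord (vbasis {:W}) i w * l (vbasis {:W})`_i)) => [w _|].
  rewrite [in RHS](coord_vbasis (memvf w)) -[l]/(l' : _ -> _) linear_sum.
  by apply: eq_bigr => i _; rewrite linearZ.
apply: regular_sum => // i _; apply: regularM => //; last exact: regular_cst.
move=> x Ux; exists U, 'X_i, 1; split=> // y _.
by rewrite /poly_fun meval1 oner_eq0 divr1 mevalXU.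
Qed.

End MapsToAffineSpace.

(** * Bases and Cramer's rule *)
Section Bases.
Variables (K : fieldType) (V : vectType K).

Lemma basis_free_size (X : seq V) :
  free X -> size X = \dim {:V} -> basis_of {:V} X.
Proof. by move=> fX sX; rewrite basisEfree fX subvf sX leqnn. Qed.

Lemma basis_coord n (X : n.-tuple V) v :
  basis_of {:V} X -> v = \sum_i coord X i v *: X`_i.
Proof. by move=> bX; apply: coord_basis bX _; exact: memvf. Qed.

Definition basis_map (W : vectType K) n (X : n.-tuple V) (Y : 'I_n -> W) :
    'Hom(V, W) :=
  linfun (sval (linear_of_free X [seq Y i | i <- enum 'I_n])).

Lemma basis_map_nth (W : vectType K) n (X : n.-tuple V) (Y : 'I_n -> W) (i : 'I_n) :
  free X -> basis_map X Y X`_i = Y i.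
Proof.
move=> fX; rewrite lfunE /=; case: linear_of_free => f /= /(_ fX).
rewrite size_map size_enum_ord size_tuple => /(_ erefl) fXY.
rewrite -(nth_map 0 0 f) ?size_tuple // fXY (nth_map i) ?size_enum_ord //.
by rewrite nth_ord_enum.
Qed.

Lemma basis_lfunP (W : vectType K) (X : seq V) (f g : 'Hom(V, W)) :
  basis_of {:V} X -> (forall v, v \in X -> f v = g v) -> f = g.
Proof.
move=> bX fg; apply/lfunP => v.
rewrite (@basis_coord _ (in_tuple X) v bX) !linear_sum; apply: eq_bigr => i _.
by rewrite !linearZ /= fg // mem_nth.
Qed.

Definition coord_mx n (b X : n.-tuple V) : 'M[K]_n :=
  \matrix_(i, j) coord b j X`_i.

Lemma coord_coord_mx n (b X : n.-tuple V) (k : 'I_n -> K) j :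
  coord b j (\sum_i k i *: X`_i) = ((\row_i k i) *m coord_mx b X) 0 j.
Proof.
rewrite linear_sum mxE; apply: eq_bigr => i _.
by rewrite linearZ !mxE.
Qed.

Lemma coord_inj n (b : n.-tuple V) u v :
  basis_of {:V} b -> (forall j, coord b j u = coord b j v) -> u = v.
Proof.
move=> bb uv; rewrite (basis_coord u bb) (basis_coord v bb).
by apply: eq_bigr => i _; rewrite uv.
Qed.

(** Linear independence of a tuple of the right length is the non-vanishing of a
    polynomial in the coordinates; hence framing by a given tree is an open
    condition. *)
Lemma free_det n (b X : n.-tuple V) :
  basis_of {:V} b -> free X = (\det (coord_mx b X) != 0).
Proof.
move=> bb; apply/idP/idP => [fX|dX].
  rewrite -unitfE -[_ \is a _]/(coord_mx b X \in unitmx) -row_free_unit.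
  rewrite -kermx_eq0; apply/eqP/row_matrixP => i; rewrite row0.
  set r := row i _; have rM : r *m coord_mx b X = 0.
    by apply: sub_kermxP; exact: row_sub.
  apply/rowP => j; rewrite [RHS]mxE.
  move/freeP: fX => fX; apply: (fX (fun j => r 0 j)); apply: (coord_inj bb) => l.
  rewrite coord_coord_mx linear0 (_ : \row_i0 r 0 i0 = r) ?rM ?mxE //.
  by apply/rowP => ?; rewrite mxE.
apply/freeP => k kX j.
have uM : coord_mx b X \in unitmx by rewrite unitmxE unitfE.
have : (\row_i k i) *m coord_mx b X = 0.
  by apply/rowP => l; rewrite -coord_coord_mx kX linear0 mxE.
move/(canRL (mulmxK uM)); rewrite mul0mx => /rowP/(_ j).
by rewrite !mxE.
Qed.

(** Cramer's rule, which exhibits the coordinates with respect to a varying basis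
    as rational functions of that basis. *)
Lemma coord_cramer n (b X : n.-tuple V) u j :
  basis_of {:V} b -> basis_of {:V} X ->
  coord X j u =
  \sum_l coord b l u * (\adj (coord_mx b X)) l j * (\det (coord_mx b X))^-1.
Proof.
move=> bb bX; have := free_det X bb; rewrite (basis_free bX) => /esym dX.
have uM : coord_mx b X \in unitmx by rewrite unitmxE unitfE.
have : \row_l coord b l u = (\row_i coord X i u) *m coord_mx b X.
  apply/rowP => l; rewrite -coord_coord_mx mxE; congr (coord _ _ _).
  exact: basis_coord.
move=> /esym/(canRL (mulmxK uM))/rowP/(_ j); rewrite [LHS]mxE => ->.
rewrite mxE; apply: eq_bigr => l _.
by rewrite /invmx uM !mxE -mulrA [_^-1 * _]mulrC.
Qed.

Lemma coord_map_inj n (X : n.-tuple V) (g : 'End(V)) i v :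
  injective g -> basis_of {:V} X -> coord (map_tuple g X) i (g v) = coord X i v.
Proof.
move=> gI bX; have fgX : free (map_tuple g X).
  apply/freeP => k /= kX j; move: j; apply: (elimT freeP (basis_free bX)).
  apply: gI; rewrite linear0 -[RHS]kX linear_sum; apply: eq_bigr => l _.
  by rewrite linearZ (nth_map 0) // size_tuple.
have cg (l : 'I_n) : coord (map_tuple g X) i (g X`_l) = (l == i)%:R.
  rewrite -(coord_free l i fgX); congr (coord _ _ _).
  by rewrite (nth_map 0) ?size_tuple.
rewrite [in LHS](basis_coord v bX) !linear_sum (bigD1 i) //= big1 ?addr0 => [|l li].
  by rewrite !linearZ /= cg eqxx mulr1.
by rewrite !linearZ /= cg (negPf li) mulr0.
Qed.

Lemma bij_lker0 (g : 'End(V)) : bijective g -> lker g == 0%VS.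
Proof. by move=> gb; apply/lker0P; exact: bij_inj. Qed.

Lemma basis_mapK n (X Y : n.-tuple V) :
  basis_of {:V} X -> basis_of {:V} Y ->
  cancel (basis_map X (fun i => Y`_i)) (basis_map Y (fun i => X`_i)).
Proof.
move=> bX bY v; rewrite -comp_lfunE -[RHS](id_lfunE v).
congr (fun_of_lfun _ v); apply: (basis_lfunP bX) => _ /tnthP[i ->].
by rewrite comp_lfunE id_lfunE (tnth_nth 0) !basis_map_nth ?(basis_free bX, basis_free bY).
Qed.

Lemma basis_map_bij n (X Y : n.-tuple V) :
  basis_of {:V} X -> basis_of {:V} Y ->
  bijective (basis_map X (fun i => Y`_i)).
Proof. by move=> bX bY; exists (basis_map Y (fun i => X`_i)); exact: basis_mapK. Qed.

End Bases.

(** * Lexicographic order on words *)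
Section LexicographicOrder.
Context {disp : Order.disp_t} {A : orderType disp}.
Implicit Types (a b : A) (u w p s t : seq A).

Local Notation "u <l w" := ((u : seqlexi A) < (w : seqlexi A))%O
  (at level 70, no associativity).

Lemma lexi_lt_cons a b u w : (a :: u <l b :: w) = (a < b)%O || (a == b) && (u <l w).
Proof. by rewrite ltxi_cons; case: (ltgtP a b). Qed.

Lemma lexi_lt_prefix u w : prefix u w -> u != w -> u <l w.
Proof.
elim: u w => [|a u IHu] [|b w] //= /andP[/eqP -> uw].
by rewrite eqseq_cons eqxx lexi_lt_cons eqxx ltxx => /IHu->.
Qed.

(** A comparison decided at a letter, and not by one word being a prefix of the
    other, is insensitive to what is appended on either side. *)
Lemma lexi_lt_cat s t u w : u <l w -> ~~ prefix u w -> u ++ s <l w ++ t.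
Proof.
elim: u w => [|a u IHu] [|b w] //.
rewrite /= !lexi_lt_cons; case: (ltgtP a b) => //= _; exact: IHu.
Qed.

Lemma lexi_lt_catW u p t :
  u <l p ++ t -> ~~ prefix p u -> ~~ prefix u p -> u <l p.
Proof.
move=> upt pu; case: (ltgtP (p : seqlexi A) u) => //.
  move=> /(lexi_lt_cat t [::])/(_ pu); rewrite cats0 => /(lt_trans upt).
  by rewrite ltxx.
by move=> pE; rewrite pE prefix_refl in pu.
Qed.

Lemma lexi_lt_split s t : s <l t -> size s = size t ->
  exists p a b s' t', [/\ s = p ++ a :: s', t = p ++ b :: t' & (a < b)%O].
Proof.
elim: s t => [|a s IHs] [|b t] //; rewrite lexi_lt_cons.
case/orP=> [ab _|/andP[/eqP<- st] [/(IHs _ st)]].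
  by exists [::], a, b, s, t.
by move=> [p [a' [b' [s' [t' [-> -> ab]]]]]]; exists (a :: p), a', b', s', t'.
Qed.

End LexicographicOrder.

Section Words.
Variable m : nat.
Implicit Types (u w p : word m) (k : 'I_m).

Lemma lexlt_prefix u w : prefix u w -> u != w -> lexlt u w.
Proof. exact: lexi_lt_prefix. Qed.

Lemma lexlt_rcons w k : lexlt w (rcons w k).
Proof.
apply: lexlt_prefix; first exact: prefix_rcons.
by apply/eqP => /(congr1 size)/eqP; rewrite size_rcons ltn_eqF.
Qed.

Definition revword w : word m := [seq rev_ord i | i <- w].

(** Reversing the alphabet reverses exactly the comparisons that are decided at a
    letter, while a prefix stays smaller. *)
Lemma lexlt_revword u w :
  lexlt u w -> ~~ prefix u w -> lexlt (revword w) (revword u).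
Proof.
rewrite /lexlt; elim: u w => [|a u IHu] [|b w] //=.
rewrite !lexi_lt_cons (inj_eq rev_ord_inj).
case: (ltgtP a b) => //= [ab _ _|_]; last first.
  by move=> uw /(IHu _ uw) ->; rewrite orbT.
move: ab; rewrite !ltEord /= => ab; rewrite ltn_sub2l ?orTb //.
exact: leq_ltn_trans (ltn_ord b).
Qed.

End Words.

(** * Trees of vectors and stable tuples *)
Section TreeSpans.
Variables (K : fieldType) (m : nat) (V : vectType K).
Implicit Types (v : word m -> V) (T : {fset word m}) (P Q : pred (word m)).
Implicit Types (w : word m) (k : 'I_m).

Definition tree_span v T P : {vspace V} :=
  <<[seq v w | w <- enum_fset T & P w]>>%VS.

Lemma mem_tree_span v T P w : w \in T -> P w -> v w \in tree_span v T P.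
Proof. by move=> wT Pw; apply/memv_span/map_f; rewrite mem_filter Pw. Qed.

Lemma tree_span_sub v T P (U : {vspace V}) :
  (forall w, w \in T -> P w -> v w \in U) -> (tree_span v T P <= U)%VS.
Proof.
move=> vU; apply/span_subvP => _ /mapP[w + ->].
by rewrite mem_filter => /andP[Pw wT]; exact: vU.
Qed.

Lemma tree_spanS v T P Q :
  (forall w, w \in T -> P w -> Q w) -> (tree_span v T P <= tree_span v T Q)%VS.
Proof.
by move=> PQ; apply: tree_span_sub => w wT Pw; apply: mem_tree_span => //; exact: PQ.
Qed.

Lemma eq_tree_span v v' T P :
  {in T, v =1 v'} -> tree_span v T P = tree_span v' T P.
Proof.
move=> vv'; congr <<_>>%VS; apply/eq_in_map => w.
by rewrite mem_filter => /andP[_ /vv'].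
Qed.

Lemma limg_tree_span (g : 'End(V)) v T P :
  (g @: tree_span v T P)%VS = tree_span (g \o v) T P.
Proof. by rewrite limg_span -map_comp. Qed.

Definition frames v T := basis_of {:V} [seq v w | w <- enum_fset T].

Lemma frames_size v T : frames v T -> #|` T| = \dim {:V}.
Proof. by move=> /andP[/eqP <- /eqP ->]; rewrite size_map. Qed.

(** The root is missing only from the empty tree, which frames only the zero
    space: this disposes of dimension zero, where normal forms agree at the root
    for want of non-zero vectors. *)
Lemma frames_no_root v T u : is_tree T -> frames v T -> [::] \notin T -> u = 0 :> V.
Proof.
move=> tT /andP[/eqP + _] T0; have -> : T = fset0.
  apply/fsetP => w; rewrite inE; apply: contraNF T0 => wT.
  by apply: tT wT; exact: prefix0s.
rewrite (size0nil (@cardfs0 (word m))) span_nil => V0.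
by apply/eqP; rewrite -memv0 V0 memvf.
Qed.

Lemma frames_map (g : 'End(V)) v T :
  bijective g -> frames v T -> frames (g \o v) T.
Proof.
move=> gb; rewrite /frames (map_comp g v) => vT.
have gK := bij_lker0 gb.
have gV : (g @: {:V})%VS = {:V}%VS.
  apply/eqP; rewrite eqEdim subvf limg_dim_eq ?leqnn //.
  exact: etrans (congr1 _ (eqP gK)) (capv0 _).
move: vT; rewrite !basisEdim -limg_span !size_map => /andP[sV sT].
by apply/andP; split=> //; rewrite -gV limgS.
Qed.

End TreeSpans.

Section FramedTuples.
Variables (K : fieldType) (m : nat) (V : vectType K).
Implicit Types (x y : pairs K m V) (T : {fset word m}) (w : word m) (k : 'I_m).
Implicit Types (g : 'End(V)) (e : word m -> V).

Definition word_vec x w : V := foldl (fun u k => x.1 k u) x.2 w.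

Lemma word_vec_rcons x w k : word_vec x (rcons w k) = x.1 k (word_vec x w).
Proof. by rewrite /word_vec -cats1 foldl_cat. Qed.

Lemma word_vec_gl g x w :
  bijective g -> word_vec (gl_act g x) w = g (word_vec x w).
Proof.
move=> gb; elim/last_ind: w => // w k IHw.
rewrite !word_vec_rcons IHw /= ffunE !comp_lfunE lker0_lfunK //.
exact: bij_lker0.
Qed.

(** The endomorphisms preserving [W] form a subalgebra containing all [x.1 k], so
    they contain the generated algebra, and the orbit of [x.2] under it is [V]. *)
Lemma stable_closed x (W : {vspace V}) : stable K m V x -> x.2 \in W ->
  (forall k u, u \in W -> x.1 k u \in W) -> W = {:V}%VS.
Proof.
move=> stx vW kW; apply/eqP; rewrite eqEsubv subvf; apply/subvP => u _.
have : [set (f : 'End(V)) x.2 | f in generated_algebra x.1] u.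
  by rewrite (stx : _ = setT).
move=> [f fA <-]; suff fW : forall u, u \in W -> f u \in W by exact: fW.
apply: (fA [set f : 'End(V) | forall u, u \in W -> f u \in W]).
split=> [|_ [k _ <-] u' u'W]; last exact: kW.
split=> [u' u'W|a g h gW hW u' u'W|g h gW hW u' u'W] /=.
- by rewrite id_lfunE.
- by rewrite lfunE /= lfunE /= memvD ?memvZ ?gW ?hW.
- by rewrite comp_lfunE gW // hW.
Qed.

Lemma generated_word_vec x w :
  exists2 f, generated_algebra x.1 f & f x.2 = word_vec x w.
Proof.
elim/last_ind: w => [|w k [f fA fE]].
  by exists \1%VF; [move=> B [[]]|rewrite id_lfunE].
exists (x.1 k \o f)%VF; last by rewrite word_vec_rcons comp_lfunE fE.
move=> B [BA Bx]; have [_ _ BM] := BA; apply: BM; last exact: fA.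
by apply: Bx; exists k.
Qed.

Lemma frames_stable x T : frames (word_vec x) T -> stable K m V x.
Proof.
move=> xT; apply/seteqP; split=> // u _.
suff comb (s : seq (word m)) (c : 'I_(size s) -> K) :
    exists2 f, generated_algebra x.1 f &
      f x.2 = \sum_i c i *: word_vec x (nth [::] s i).
  have [f fA fE] := comb (enum_fset T)
    (fun i => coord (map_tuple (word_vec x) (in_tuple (enum_fset T))) i u).
  exists f => //; rewrite fE [RHS](@basis_coord _ _ _
    (map_tuple (word_vec x) (in_tuple (enum_fset T))) u) //.
  by apply: eq_bigr => i _; rewrite (nth_map [::]).
suff sumA (I : Type) (r : seq I) (a : I -> K) (z : I -> word m) :
    exists2 f, generated_algebra x.1 f &
      f x.2 = \sum_(i <- r) a i *: word_vec x (z i) by exact: sumA.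
elim: r => [|i r [f fA fE]].
  exists 0; last by rewrite big_nil lfunE.
  move=> B [[B1 BL _] _]; have := BL (-1) _ _ B1 B1.
  by rewrite scaleN1r addNr.
have [h hA hE] := generated_word_vec x (z i).
exists (a i *: h + f); last by rewrite big_cons lfunE /= lfunE /= hE fE.
move=> B BA; have [[_ BL _] _] := BA.
by apply: BL; [exact: hA|exact: fA].
Qed.

(** The condition on the images that leave the tree is stated for the vectors
    [word_vec x w] in place of a fixed basis, so that it makes sense on a whole
    orbit. The relation [P w k u] selects the tree words [u] that may occur in the
    expansion of [word_vec x (rcons w k)]; two choices of it describe the cells and
    their punctual parts. *)
Definition staircase (P : word m -> 'I_m -> pred (word m)) T x : Prop :=
  frames (word_vec x) T /\ forall w k, w \in T -> rcons w k \notin T ->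
    word_vec x (rcons w k) \in tree_span (word_vec x) T (P w k).

Lemma frames_gl g x T : bijective g ->
  frames (word_vec x) T -> frames (word_vec (gl_act g x)) T.
Proof.
move=> gb /(frames_map gb); rewrite /frames; congr (basis_of _ _).
by apply: eq_map => w; rewrite word_vec_gl.
Qed.

Lemma staircase_gl P g x T :
  bijective g -> staircase P T x -> staircase P T (gl_act g x).
Proof.
move=> gb [xT xP]; split=> [|w k wT wkT]; first exact: frames_gl.
rewrite word_vec_gl // (@eq_tree_span _ _ _ _ (g \o word_vec x)) => [|u _].
  by rewrite -limg_tree_span memv_img // xP.
by rewrite word_vec_gl.
Qed.

(** Each orbit of a framed tuple meets the locus where the vectors of the tree are
    the chosen basis. *)
Lemma normal_form x T e : frames (word_vec x) T -> frames e T ->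
  exists2 g : 'End(V), bijective g & {in T, word_vec (gl_act g x) =1 e}.
Proof.
move=> xT eT.
pose X := map_tuple (word_vec x) (in_tuple (enum_fset T)).
pose E := map_tuple e (in_tuple (enum_fset T)).
have gb : bijective (basis_map X (fun i => E`_i)) by exact: basis_map_bij.
exists (basis_map X (fun i => E`_i)) => // w wT; rewrite word_vec_gl //.
have wi : (index w (enum_fset T) < size (enum_fset T))%N by rewrite index_mem.
have := basis_map_nth (fun i => E`_i) (Ordinal wi) (basis_free (xT : basis_of _ X)).
by rewrite !(nth_map [::]) //= nth_index.
Qed.

End FramedTuples.

(** * The cell of a point as its depth-first tree *)
Section TreeOrder.
Variable m : nat.
Implicit Types (T : {fset word m}) (u w : word m).

(** Trees are compared through the increasing lists of their words. For trees of
    the same size the smaller one is the one that contains the least word on which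
    the two differ. *)
Definition tree_key T : seqlexi (seqlexi 'I_m) :=
  sort (<=%O : rel (seqlexi 'I_m)) (enum_fset T).

Lemma mem_tree_key T u : (u \in (tree_key T : seq (word m))) = (u \in T).
Proof. by rewrite mem_sort. Qed.

Lemma size_tree_key T : size (tree_key T) = #|` T|.
Proof. by rewrite size_sort. Qed.

Lemma tree_key_inj : injective tree_key.
Proof. by move=> T T' TT'; apply/fsetP => u; rewrite -!mem_tree_key TT'. Qed.

Lemma tree_key_cut T (p : seq (word m)) a s u :
  tree_key T = p ++ a :: s -> u \in T -> lexlt u a = (u \in p).
Proof.
move=> TE uT; have := fset_uniq T.
rewrite -(sort_lt_sorted (enum_fset T : seq (seqlexi 'I_m))).
rewrite -[sort _ _]/(tree_key T) TE (sorted_pairwise lt_trans).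
rewrite pairwise_cat pairwise_cons allrel_consr.
move=> /and3P[/andP[/allP pa _] _ /andP[/allP as_ _]].
move: uT; rewrite -mem_tree_key TE mem_cat in_cons.
case: (boolP (u \in p)) => [up _|_ /= /orP[/eqP->|us]].
- exact: pa.
- exact: ltxx.
- by apply: lt_gtF; exact: as_.
Qed.

Lemma tree_key_ltP T T' : (tree_key T < tree_key T')%O -> #|` T| = #|` T'| ->
  exists u, [/\ u \in T, u \notin T',
    exists2 b, b \in T' & lexlt u b &
    forall w, lexlt w u -> (w \in T) = (w \in T')].
Proof.
rewrite -!size_tree_key => /lexi_lt_split/[apply] -[p [a [b [s [t [TE T'E ab]]]]]].
have aT : a \in T by rewrite -mem_tree_key TE mem_cat mem_head orbT.
have bT' : b \in T' by rewrite -mem_tree_key T'E mem_cat mem_head orbT.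
have pT w : w \in p -> w \in T by rewrite -mem_tree_key TE mem_cat => ->.
have pT' w : w \in p -> w \in T' by rewrite -mem_tree_key T'E mem_cat => ->.
have wE w : lexlt w a -> (w \in T) = (w \in T').
  move=> wa; apply/idP/idP => wT.
    by apply: pT'; rewrite -(tree_key_cut TE).
  by apply: pT; rewrite -(tree_key_cut T'E) // /lexlt (lt_trans wa).
exists a; split=> //; last by exists b.
apply/negP => aT'; have : lexlt a a by rewrite (tree_key_cut TE) // -(tree_key_cut T'E).
by rewrite /lexlt ltxx.
Qed.

End TreeOrder.

Section DepthFirst.
Variables (K : fieldType) (m : nat) (V : vectType K).
Implicit Types (x : pairs K m V) (T : {fset word m}) (u w : word m) (k : 'I_m).
Implicit Types (v : word m -> V).

Definition lex_below w k : pred (word m) := fun u => lexlt u (rcons w k).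

Lemma free_tree_span v T P u :
  free [seq v w | w <- enum_fset T] -> u \in T -> v u \in tree_span v T P -> P u.
Proof.
move=> vT uT vu; apply: contraTT vu => Pu.
have : perm_eq [seq v w | w <- enum_fset T] (v u :: [seq v w | w <- rem u (enum_fset T)]).
  by rewrite -map_cons perm_map // perm_to_rem.
move=> /perm_free; rewrite vT => /esym; rewrite free_cons => /andP[+ _].
apply: contra; apply/subvP/sub_span => _ /mapP[w + ->].
rewrite mem_filter => /andP[Pw wT]; apply: map_f.
by rewrite mem_rem_uniq ?fset_uniq // inE wT andbT; apply: contraNneq Pu => <-.
Qed.

(** At the least word [u = rcons w k] on which the trees differ, if [u] belonged to
    [T], then [w] would lie in both trees and the vector of [u] would be a
    combination of earlier vectors, which [T0] and [T] share; this contradicts the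
    independence of the vectors of [T]. So the tree of the staircase is the least
    tree framing [x]. *)
Lemma staircase_key_le x T0 T : is_tree T0 -> is_tree T -> #|` T0| = #|` T| ->
  staircase lex_below T0 x -> frames (word_vec x) T ->
  (tree_key T0 <= tree_key T)%O.
Proof.
move=> tT0 tT szT [_ xT0] xT; rewrite leNgt; apply/negP => /tree_key_ltP/(_ (esym szT)).
case=> u; case/lastP: u => [|w k] [uT uT0 [b bT0 _] uE].
  by move: uT0; rewrite (tT0 [::] b) ?prefix0s.
have wT0 : w \in T0.
  by rewrite -uE ?lexlt_rcons //; apply: tT uT; exact: prefix_rcons.
have := xT0 w k wT0 uT0.
move=> /(subvP (tree_span_sub _)) => uspan.
have : word_vec x (rcons w k) \in tree_span (word_vec x) T (lex_below w k).
  apply: uspan => z zT0 zu; apply: mem_tree_span => //; by rewrite uE.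
by move/(free_tree_span (basis_free xT) uT); rewrite /lex_below /lexlt ltxx.
Qed.

Lemma key_lt_of_new T T' u : #|` T| = #|` T'| -> u \in T' -> u \notin T ->
  (forall w, w \in T -> lexlt w u -> w \in T') -> (tree_key T' < tree_key T)%O.
Proof.
move=> szT uT' uT TT'; rewrite ltNge le_eqVlt; apply/negP => /orP[/eqP/tree_key_inj TE|].
  by rewrite TE uT' in uT.
move=> /tree_key_ltP/(_ szT) [a [aT aT' _ aE]].
case: (ltgtP (u : seqlexi 'I_m) a) => [ua|au|uE].
- by rewrite (aE u ua) uT' in uT.
- by rewrite (TT' a) in aT'.
- by rewrite -uE uT' in aT'.
Qed.

Lemma is_tree_fset0 : is_tree (fset0 : {fset word m}).
Proof. by move=> u w _; rewrite inE. Qed.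

Lemma is_tree_add T w k : is_tree T -> w \in T -> is_tree (rcons w k |` T)%fset.
Proof.
move=> tT wT u z uz; rewrite !inE => /orP[/eqP zE|zT]; last first.
  by rewrite (tT u z) ?orbT.
move: uz; rewrite zE prefixE => /eqP uE.
have [uk|ku] := leqP (size u) (size w); last first.
  by rewrite -{1}uE take_oversize ?eqxx // size_rcons.
rewrite (tT u w) ?orbT // prefixE -{2}uE.
by rewrite -cats1 takel_cat.
Qed.

(** While the vectors of [T] do not span, stability yields either [x.2] outside
    their span or a letter moving one of them out of it, hence a word that can be
    added to the tree. *)
Lemma frame_extend x T : stable K m V x -> is_tree T ->
  free [seq word_vec x w | w <- enum_fset T] ->
  exists T', [/\ trees m (\dim {:V}) T', (T `<=` T')%fset & frames (word_vec x) T'].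
Proof.
move=> stx; have [n] := ubnP (\dim {:V} - #|` T|); elim: n T => // n IHn T.
rewrite ltnS => Tn tT fT.
have szT : (#|` T| <= \dim {:V})%N.
  have := dimvS (subvf <<[seq word_vec x w | w <- enum_fset T]>>).
  by move: fT => /eqP ->; rewrite size_map.
move: szT; rewrite leq_eqVlt => /orP[/eqP szT|szT].
  by exists T; split=> //; apply: basis_free_size => //; rewrite size_map.
have add u : word_vec x u \notin <<[seq word_vec x w | w <- enum_fset T]>>%VS ->
    is_tree (u |` T)%fset ->
    exists T', [/\ trees m (\dim {:V}) T', (T `<=` T')%fset & frames (word_vec x) T'].
  move=> uT tT'.
  have unT : u \notin T by apply: contra uT => uT; apply/memv_span/map_f.
  case: (IHn (u |` T)%fset) => //.
  - rewrite cardfsU1 unT add1n subnS.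
    by apply: leq_trans Tn; rewrite prednK // subn_gt0.
  - have /perm_free -> : perm_eq [seq word_vec x w | w <- enum_fset (u |` T)%fset]
        (word_vec x u :: [seq word_vec x w | w <- enum_fset T]).
      rewrite -map_cons perm_map //; apply: uniq_perm; first exact: fset_uniq.
        by rewrite /= fset_uniq andbT; exact: unT.
      by move=> z; rewrite !inE.
    by rewrite free_cons uT.
  move=> T' [tT'' TT' xT']; exists T'; split=> //.
  exact: fsubset_trans (fsubsetU1 _ _) TT'.
have [vT|vT] := boolP (x.2 \in <<[seq word_vec x w | w <- enum_fset T]>>%VS); last first.
  apply: (add [::]) => // u w uw; rewrite !inE => /orP[/eqP wE|wT].
    by move: uw; rewrite wE prefixs0 => ->.
  by rewrite (tT u w) ?orbT.
have [kT|] := boolP [forall k, all (fun w => word_vec x (rcons w k) \in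
    <<[seq word_vec x w | w <- enum_fset T]>>%VS) (enum_fset T)].
  have spanT : <<[seq word_vec x w | w <- enum_fset T]>>%VS = {:V}%VS.
    apply: (stable_closed stx) => // k u uT.
    apply: (subvP _ _ (memv_img (x.1 k) uT)); rewrite limg_span.
    apply/span_subvP => _ /mapP[_ /mapP[w wT ->] ->].
    by rewrite -word_vec_rcons; move/forallP: kT => /(_ k) /allP; exact.
  by move: szT fT; rewrite /free spanT size_map => /ltn_eqF; rewrite eq_sym => ->.
rewrite negb_forall => /existsP[k /allPn[w wT wk]].
by apply: (add _ wk); exact: is_tree_add.
Qed.

End DepthFirst.
Arguments lex_below {m}.

Section FiniteTrees.
Variable m : nat.
Implicit Types (T : {fset word m}) (w : word m).

Lemma tree_size_lt T w : is_tree T -> w \in T -> (size w < #|` T|)%N.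
Proof.
move=> tT wT; pose ps := [seq take i w | i <- iota 0 (size w).+1].
have <- : size ps = (size w).+1 by rewrite size_map size_iota.
apply: uniq_leq_size.
  rewrite map_inj_in_uniq ?iota_uniq // => i j; rewrite !mem_iota /= !ltnS => iw jw.
  by move=> /(congr1 size); rewrite !size_takel.
move=> _ /mapP[i _ ->]; apply: (tT _ w) => //.
by rewrite -[X in prefix _ X](cat_take_drop i) prefix_prefix.
Qed.

Lemma trees_enum d : exists s : seq {fset word m},
  [/\ uniq s, [set` s] = trees m d &
      sorted (fun T T' => tree_key T' < tree_key T)%O s].
Proof.
pose words := flatten [seq [seq val t | t : n.-tuple 'I_m] | n <- iota 0 d].
pose trs := [seq T <- enum_fset (fpowerset [fset w in words]%fset) | `[< trees m d T >]].
pose geK := (fun T T' => tree_key T' <= tree_key T)%O.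
have geK_total : total geK by move=> T T'; exact: le_total.
have geK_trans : transitive geK by move=> T T' T'' h /le_trans; exact.
have trs_uniq : uniq (sort geK trs) by rewrite sort_uniq filter_uniq // fset_uniq.
exists (sort geK trs); split=> //.
- apply/seteqP; split=> T /=; rewrite mem_sort mem_filter.
    by move=> /andP[/asboolP].
  move=> tT.
  have [TT Td] := tT; apply/andP; split; first exact/asboolP.
  rewrite -[_ \in _]/(T \in fpowerset _) fpowersetE; apply/fsubsetP => w wT.
  rewrite inE; apply/flattenP; exists [seq val t | t : (size w).-tuple 'I_m].
    by apply: map_f; rewrite mem_iota add0n -Td tree_size_lt.
  by apply/mapP; exists (in_tuple w); rewrite ?mem_enum.
- rewrite sorted_pairwise; last by move=> T T' T'' h /lt_trans; exact.
  have := sort_sorted geK_total trs; rewrite sorted_pairwise // => sK.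
  move: trs_uniq sK; elim: (sort geK trs) => //= T s IHs /andP[Ts us] /andP[Ks sK].
  rewrite IHs // andbT; apply/allP => T' T's; rewrite lt_neqAle.
  apply/andP; split; last exact: (allP Ks).
  by apply: contraNneq Ts => /tree_key_inj <-.
Qed.

Lemma min_tree_key (s : seq {fset word m}) (P : {fset word m} -> Prop) T :
  T \in s -> P T -> exists T0, [/\ T0 \in s, P T0 &
    forall T', T' \in s -> P T' -> (tree_key T0 <= tree_key T')%O].
Proof.
elim: s T => // T s IHs T'; rewrite inE => /predU1P[-> PT|T's PT'].
  have [[T1 [T1s PT1]]|nos] := pselect (exists T1, T1 \in s /\ P T1).
    have [T0 [T0s PT0 T0min]] := IHs T1 T1s PT1.
    have [le01|lt10] := leP (tree_key T) (tree_key T0).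
      exists T; split=> //; first exact: mem_head.
      move=> T2; rewrite inE => /predU1P[->|T2s PT2]; first by rewrite lexx.
      exact: le_trans le01 (T0min _ T2s PT2).
    exists T0; split=> //; first by rewrite inE T0s orbT.
    move=> T2; rewrite inE => /predU1P[-> _|T2s PT2]; first exact: ltW.
    exact: T0min.
  exists T; split=> //; first exact: mem_head.
  move=> T2; rewrite inE => /predU1P[->|T2s PT2]; first by rewrite lexx.
  by case: nos; exists T2.
have [T0 [T0s PT0 T0min]] := IHs T' T's PT'.
have [[PT lt0]|nlt] := pselect (P T /\ (tree_key T < tree_key T0)%O).
  exists T; split=> //; first exact: mem_head.
  move=> T2; rewrite inE => /predU1P[->|T2s PT2]; first by rewrite lexx.
  exact: le_trans (ltW lt0) (T0min _ T2s PT2).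
exists T0; split=> //; first by rewrite inE T0s orbT.
move=> T2; rewrite inE => /predU1P[-> PT|T2s PT2]; last exact: T0min.
by rewrite leNgt; apply/negP => lt0; apply: nlt.
Qed.

End FiniteTrees.

Section DepthFirstExistence.
Variables (K : fieldType) (m : nat) (V : vectType K).
Implicit Types (x : pairs K m V) (T : {fset word m}).

(** Take the least tree [T] framing [x]. If the vector of [rcons w k] were not a
    combination of the vectors of smaller words of [T], these words together with
    [rcons w k] would form an independent tree [B]. Any framing tree containing it
    would be less than [T]. *)
Lemma depth_first_tree x : stable K m V x ->
  exists2 T, trees m (\dim {:V}) T & staircase lex_below T x.
Proof.
move=> stx.
have [|T1 [tT1 _ xT1]] := frame_extend stx (@is_tree_fset0 m).
  by rewrite (size0nil (@cardfs0 (word m))) nil_free.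
have [s [_ sE _]] := trees_enum m (\dim {:V}).
have trs T : (T \in s) <-> trees m (\dim {:V}) T.
  by have /(congr1 (fun A : set _ => A T)) /= := sE; move=> ->.
have [T [/trs tT xT Tmin]] :=
  min_tree_key (P := fun T => frames (word_vec x) T) (proj2 (trs _) tT1) xT1.
exists T => //; split=> // w k wT wkT; apply: contrapT => /negP wk.
have [tT' szT] := tT.
pose B := [fset u in T | lexlt u (rcons w k)]%fset.
have BE u : (u \in B) = (u \in T) && lexlt u (rcons w k) by rewrite !inE.
have tB : is_tree (rcons w k |` B)%fset.
  move=> u z uz; rewrite !inE => /orP[/eqP zE|/andP[zT zk]]; last first.
    rewrite (tT' u z) //=; apply/orP; right.
    have [->//|uz'] := eqVneq u z.
    by apply: lt_trans zk; exact: lexlt_prefix.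
  have [->//|uz'] := eqVneq u z; first by rewrite zE eqxx.
  apply/orP; right; rewrite -zE lexlt_prefix // andbT; apply: tT' wT.
  move: uz; rewrite zE => uz; move: uz'; rewrite zE.
  move: uz; rewrite !prefixE => /eqP uE.
  have [uk _|ku] := leqP (size u) (size w).
    by rewrite -{2}uE -cats1 takel_cat.
  by rewrite -{1}uE take_oversize ?eqxx // size_rcons.
have fB : free [seq word_vec x u | u <- enum_fset (rcons w k |` B)%fset].
  have /perm_free -> : perm_eq [seq word_vec x u | u <- enum_fset (rcons w k |` B)%fset]
      (word_vec x (rcons w k) :: [seq word_vec x u | u <- enum_fset T & lex_below w k u]).
    rewrite -map_cons perm_map //; apply: uniq_perm; first exact: fset_uniq.
      rewrite /= mem_filter negb_and orbC wkT /= filter_uniq //; exact: fset_uniq.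
    by move=> z; rewrite !inE mem_filter andbC.
  rewrite free_cons wk /= (@catl_free _ _
    [seq word_vec x u | u <- enum_fset T & predC (lex_below w k) u]) //.
  rewrite -map_cat (perm_free (perm_map _ (permEl (perm_filterC _ _)))).
  exact: basis_free xT.
have [T' [trT' BT' xT']] := frame_extend stx tB fB.
have : (tree_key T' < tree_key T)%O.
  apply: (@key_lt_of_new _ _ _ (rcons w k)) => //.
  - by rewrite szT (proj2 trT').
  - by apply: (fsubsetP BT'); rewrite !inE eqxx.
  - by move=> u uT uk; apply: (fsubsetP BT'); rewrite !inE uT uk orbT.
by rewrite ltNge Tmin //; apply/trs.
Qed.

End DepthFirstExistence.

(** * Nilpotency forces the coefficients at prefixes to vanish *)
Section Nilpotency.
Variables (K : fieldType) (m : nat) (V : vectType K).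
Implicit Types (x : pairs K m V) (T : {fset word m}) (u w p : word m) (k : 'I_m).

(** Words that may occur in the expansion at a nilpotent point: those smaller than
    [rcons w k], other than [w] and its ancestors in the tree. *)
Definition lex_strict w k : pred (word m) :=
  fun u => lexlt u (rcons w k) && ~~ prefix u w.

Lemma strict_below x T : staircase lex_strict T x -> staircase (@lex_below m) T x.
Proof.
move=> [xT xP]; split=> // w k wT wkT.
by apply: (subvP (tree_spanS _ _)) (xP w k wT wkT) => u _ /andP[].
Qed.

(** The words allowed at a nilpotent point come strictly after [w] when letters
    are compared backwards: this is the order making all the [x.1 k]
    simultaneously strictly triangular. *)
Lemma strict_revword w k u :
  lexlt u (rcons w k) -> ~~ prefix u w -> lexlt (revword w) (revword u).
Proof.
move=> uwk uw; have [wu|wu] := boolP (prefix w u).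
  have wNu : w != u by apply: contraNneq uw => ->; exact: prefix_refl.
  apply: lexlt_prefix; last by rewrite (inj_eq (inj_map rev_ord_inj)).
  by move: wu => /prefixP[s ->]; rewrite /revword map_cat prefix_prefix.
apply: lexlt_revword => //; rewrite -cats1 in uwk.
exact: lexi_lt_catW uwk wu uw.
Qed.

(** The flag is spanned by the final segments of the tree in the order of
    reversed words. *)
Lemma strict_nilpotent x T : staircase lex_strict T x -> sim_nilpotent x.1.
Proof.
move=> [xT xP].
pose leR : rel (word m) := fun u w => (revword w <= revword u :> seqlexi 'I_m)%O.
have leR_total : total leR by move=> u w; exact: le_total.
have leR_refl : reflexive leR by move=> u; exact: lexx.
have leR_trans : transitive leR by move=> u w z h /le_trans; exact.
pose t := sort leR (enum_fset T).
have tT u : (u \in t) = (u \in T) by rewrite mem_sort.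
have szt : size t = \dim {:V}.
  by rewrite size_sort; exact: frames_size xT.
have xt : free [seq word_vec x w | w <- t].
  by rewrite (perm_free (perm_map _ (permEl (perm_sort _ _)))); exact: basis_free xT.
exists (fun i => <<[seq word_vec x w | w <- take i t]>>%VS); split=> [i id|i id|k i id].
- have : free [seq word_vec x w | w <- take i t].
    by move: xt; rewrite -{1}(cat_take_drop i t) map_cat => /catl_free.
  by move/eqP => ->; rewrite size_map size_takel // szt.
- apply: sub_span => _ /mapP[w wi ->]; apply: map_f.
  have wt := mem_take wi; move: wi; rewrite !in_take //; exact: ltnW.
- rewrite limg_span; apply/span_subvP => _ /mapP[_ /mapP[w wi ->] ->].
  have wt := mem_take wi; move: wi; rewrite in_take // ltnS => wi.
  have low u : u \in T -> lexlt (revword w) (revword u) ->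
      word_vec x u \in <<[seq word_vec x w | w <- take i t]>>%VS.
    move=> uT wu; apply/memv_span/map_f; rewrite in_take ?tT //.
    apply: leq_trans wi; rewrite ltnNge; apply/negP => wuI.
    have := sorted_leq_index leR_trans leR_refl (sort_sorted leR_total (enum_fset T)).
    move=> /(_ w u wt); rewrite tT => /(_ uT wuI); rewrite /leR leNgt.
    by rewrite [(_ < _)%O]wu.
  rewrite -word_vec_rcons; have [wkT|wkT] := boolP (rcons w k \in T).
    apply: low => //; apply: lexlt_prefix; rewrite ?(inj_eq (inj_map rev_ord_inj)).
      by rewrite /revword map_rcons prefix_rcons.
    by apply/eqP => /(congr1 size)/eqP; rewrite size_rcons ltn_eqF.
  apply: (subvP (tree_span_sub _)) (xP w k _ wkT); rewrite -?tT // => u.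
  by move=> uT /andP[uwk uw]; apply: low => //; exact: strict_revword uwk uw.
Qed.

(** Induction on the length [n] of the prefixes excluded so far. Let [p] be the
    prefix of length [n] of a tree word [w], and let [W] be the span of the vectors
    of words branching off below [p]; by the induction hypothesis [W] is invariant.
    If [F] is the nilpotent flag and [N] is minimal with the vector of [p] in
    [F N + W], the vectors of the proper descendants of [p], and the image in
    question, lie in [F (N - 1) + W]. All the terms of its expansion except the one
    at [p] lie there as well, so the coefficient at [p] is zero by minimality. *)
Lemma nilpotent_strict x T : is_tree T -> staircase (@lex_below m) T x ->
  sim_nilpotent x.1 -> staircase lex_strict T x.
Proof.
move=> tT [xT xP] [F [dimF F_le F_nil]]; split=> // w k wT wkT.
pose low n w k : pred (word m) :=
  fun u => lexlt u (rcons w k) && ~~ (prefix u w && (size u < n)%N).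
suff /(_ (size w).+1 w k wT wkT) : forall n w k, w \in T -> rcons w k \notin T ->
    word_vec x (rcons w k) \in tree_span (word_vec x) T (low n w k).
  apply/subvP/tree_spanS => u _ /andP[uwk]; rewrite /lex_strict uwk /=.
  by apply: contra => uw; rewrite uw ltnS size_prefix.
clear w k wT wkT; elim=> [|n IHn] w k wT wkT.
  apply: (subvP (tree_spanS _ _)) (xP w k wT wkT) => u _ uwk.
  by apply/andP; rewrite ltn0 andbF.
have [wn|nw] := ltnP (size w) n.
  apply: (subvP (tree_spanS _ _)) (IHn w k wT wkT) => u _ /andP[uwk h].
  apply/andP; split=> //; apply: contra h => /andP[uw _].
  by rewrite uw (leq_ltn_trans _ wn) // size_prefix.
pose p := take n w; have wE : w = p ++ drop n w by rewrite cat_take_drop.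
have pw : prefix p w by rewrite wE prefix_prefix.
have sp : size p = n by rewrite size_takel.
have pT : p \in T by exact: tT wT.
pose W := tree_span (word_vec x) T (fun u => lexlt u p && ~~ prefix u p).
(* [W] is invariant: a smaller word that is a prefix of [p] would be a prefix of
   [u] of length less than [n], and such words are excluded by induction. *)
have stepW j a : a \in W -> x.1 j a \in W.
  move=> aW; apply: (subvP _ _ (memv_img (x.1 j) aW)); rewrite limg_tree_span.
  apply: tree_span_sub => u uT /andP[up uNp] /=; rewrite -word_vec_rcons.
  have ujp : lexlt (rcons u j) p.
    by have := lexi_lt_cat [:: j] [::] up uNp; rewrite cats0 cats1.
  have [ujT|ujT] := boolP (rcons u j \in T).
    apply: mem_tree_span => //; rewrite ujp; apply: contra uNp.
    exact/prefix_trans/prefix_rcons.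
  apply: (subvP (tree_spanS _ _)) (IHn u j uT ujT) => z _ /andP[zuj zu].
  rewrite [lexlt z p](lt_trans zuj) //=; apply: contra zu => zp.
  have zu : prefix z u.
    apply: contraT => zu; have uz : ~~ prefix u z.
      by apply: contra uNp => uz; exact: prefix_trans zp.
    have zu' : lexlt z u by apply: (@lexi_lt_catW _ _ _ _ [:: j]) uz zu; rewrite cats1.
    have /prefixP[s pE] := zp; have := lexi_lt_cat s [::] zu' zu.
    by rewrite -pE cats0 => /lt_trans/(_ up); rewrite ltxx.
  rewrite zu /= ltn_neqAle -{2}sp size_prefix // andbT -sp.
  apply: contraL up => /eqP szp.
  have <- : z = p.
    have /prefixP[s pE] := zp; move: szp; rewrite pE size_cat -[LHS]addn0.
    by move=> /addnI/esym/size0nil->; rewrite cats0.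
  rewrite /lexlt -leNgt le_eqVlt; have [->|zNu] := eqVneq z u; first by [].
  by rewrite /= [(z < u :> seqlexi _)%O]lexlt_prefix ?orbT.
have ex_flag : exists i, word_vec x p \in (F i + W)%VS.
  exists (\dim {:V}); apply: (subvP (addvSl _ _)).
  have /eqP -> : F (\dim {:V}) == {:V}%VS by rewrite eqEdim subvf dimF /=.
  exact: memvf.
case: (ex_minnP ex_flag) => -[|N] pN Nmin.
  have /eqP F0 : F 0%N == 0%VS by rewrite -dimv_eq0 dimF.
  move: pN; rewrite F0 add0v => /(free_tree_span (basis_free xT) pT).
  by rewrite prefix_refl andbF.
have Nd : (N < \dim {:V})%N.
  apply: Nmin; apply: (subvP (addvSl _ _)).
  have /eqP -> : F (\dim {:V}) == {:V}%VS by rewrite eqEdim subvf dimF /=.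
  exact: memvf.
have stepF j a : a \in (F N.+1 + W)%VS -> x.1 j a \in (F N + W)%VS.
  move=> /memv_addP[{}a aF [b bW ->]]; rewrite linearD.
  apply: memv_add; last exact: stepW.
  exact: (subvP (F_nil j N Nd)) (memv_img _ aF).
have FW : (F N + W <= F N.+1 + W)%VS by apply: addvS; [exact: F_le|exact: subvv].
have desc s : word_vec x (p ++ s) \in (F N.+1 + W)%VS.
  elim/last_ind: s => [|s j IHs]; first by rewrite cats0.
  rewrite -rcons_cat word_vec_rcons; exact/(subvP FW)/stepF.
have desc_proper s j : word_vec x (p ++ rcons s j) \in (F N + W)%VS.
  by rewrite -rcons_cat word_vec_rcons; exact: stepF.
(* A remaining word is a proper descendant of [p] or branches off below [p]: the
   prefixes of [w] of length at most [n] are gone. *)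
have lowFW : (tree_span (word_vec x) T (low n.+1 w k) <= F N + W)%VS.
  apply: tree_span_sub => u uT /andP[uwk uw].
  have [/prefixP[s uE]|pu] := boolP (prefix p u).
    rewrite uE; case/lastP: s uE => [uE|s j _]; last exact: desc_proper.
    by move: uw; rewrite uE cats0 pw sp ltnSn.
  have up : ~~ prefix u p.
    apply: contra uw => up; rewrite (prefix_trans up pw) ltnS -sp.
    exact: size_prefix.
  apply: (subvP (addvSr _ _)); apply: mem_tree_span => //; rewrite up andbT.
  by apply: (@lexi_lt_catW _ _ _ _ (rcons (drop n w) k)) => //; rewrite -rcons_cat -wE.
have pwk : word_vec x (rcons w k) \in (F N + W)%VS.
  by rewrite {1}wE rcons_cat; exact: desc_proper.
have : word_vec x (rcons w k) \in
    (<[word_vec x p]> + tree_span (word_vec x) T (low n.+1 w k))%VS.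
  apply: (subvP (tree_span_sub _)) (IHn w k wT wkT) => u uT /andP[uwk uw].
  have [->|uNp] := eqVneq u p; first by apply: (subvP (addvSl _ _)); exact: memv_line.
  apply: (subvP (addvSr _ _)); apply: mem_tree_span => //; apply/andP; split=> //.
  apply: contra uw => /andP[uPw un]; rewrite uPw ltn_neqAle -ltnS un andbT.
  apply: contra uNp => /eqP szu; have /prefixP[s wE'] := uPw.
  by rewrite /p wE' -szu take_size_cat.
move=> /memv_addP[_ /vlineP[c ->] [y yT wkE]].
have cp : c *: word_vec x p \in (F N + W)%VS.
  rewrite -[_ *: _](addrK y) -wkE rpredB //; exact: (subvP lowFW).
have [c0|c0] := eqVneq c 0; first by rewrite wkE c0 scale0r add0r.
have : word_vec x p \in (F N + W)%VS.
  by rewrite -[word_vec x p](scalerK c0) memvZ.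
by move/Nmin; rewrite ltnn.
Qed.

End Nilpotency.

(** * Cells and the punctual locus in terms of representatives *)
Section HilbertCells.
Variables (K : fieldType) (m : nat) (V : vectType K).
Implicit Types (T : {fset word m}) (e : word m -> V) (g : 'End(V)).

Local Notation H := (hilb K m V).
Local Notation stab := (subvariety (stable K m V)).

Lemma hilb_classP (x y : stab) :
  hilb_class x = hilb_class y <->
  exists g, bijective g /\ val y = gl_act g (val x).
Proof.
split=> [/eqmodP/asboolP//|xy].
by apply/eqmodP/asboolP.
Qed.

Lemma hilb_class_repr (q : H) : hilb_class (repr q) = q.
Proof. exact: reprK. Qed.

Lemma sim_nilpotent_gl g (x : pairs K m V) :
  bijective g -> sim_nilpotent x.1 -> sim_nilpotent (gl_act g x).1.
Proof.
move=> gb [F [dimF F_le F_nil]].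
have gK := bij_lker0 gb.
exists (fun i => g @: F i)%VS; split=> [i id|i id|k i id].
- rewrite limg_dim_eq ?dimF //; exact: etrans (congr1 _ (eqP gK)) (capv0 _).
- exact/limgS/F_le.
- rewrite /= ffunE -limg_comp -comp_lfunA lker0_compVf // comp_lfun1r.
  by rewrite limg_comp limgS // F_nil.
Qed.

Lemma punctual_hilbP (x : stab) :
  punctual_hilb K m V (hilb_class x) <-> sim_nilpotent (val x).1.
Proof.
split=> [[y yn /hilb_classP[g [gb ->]]]|xn]; first exact: sim_nilpotent_gl.
by exists x.
Qed.

Lemma cell_lift_word_vec T e x : is_tree T -> cell_lift T e x ->
  {in T, word_vec x =1 e}.
Proof.
move=> tT [x0 xk _] w; elim/last_ind: w => // w k IHw wkT.
have wT : w \in T by apply: tT wkT; exact: prefix_rcons.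
by rewrite word_vec_rcons IHw // xk.
Qed.

Lemma cellP T e (x : stab) : is_tree T -> frames e T ->
  cell T e (hilb_class x) <-> staircase (@lex_below m) T (val x).
Proof.
move=> tT eT; split=> [[y ye /hilb_classP[g [gb ->]]]|xT].
  have yE := cell_lift_word_vec tT ye; have [_ _ yk] := ye.
  apply: staircase_gl => //; split=> [|w k wT wkT].
    by rewrite /frames (proj1 (eq_in_map _ e _) yE).
  rewrite (eq_tree_span _ yE) word_vec_rcons yE //; exact: yk.
have [g gb gE] := normal_form xT.1 eT.
have [yT yk] := staircase_gl gb xT.
have yst : gl_act g (val x) \in stable K m V by apply/mem_set/(frames_stable yT).
exists (exist (fun z => z \in stable K m V) _ yst : stab); last first.
  by apply/esym/hilb_classP; exists g.
split=> [|w k wT wkT|w k wT wkT] /=.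
- have [eT0|eT0] := boolP ([::] \in T); first by rewrite -gE.
  by rewrite [LHS](frames_no_root _ tT eT eT0) [RHS](frames_no_root _ tT eT eT0).
- by rewrite -gE // -[RHS]gE // word_vec_rcons.
- have := yk w k wT wkT; rewrite word_vec_rcons gE //.
  by rewrite (eq_tree_span _ gE).
Qed.

Lemma cell_punctualP T e (x : stab) : is_tree T -> frames e T ->
  (cell T e `&` punctual_hilb K m V) (hilb_class x) <->
  staircase (@lex_strict m) T (val x).
Proof.
move=> tT eT; split=> [[/cellP xT /punctual_hilbP xn]|xT].
  by apply: nilpotent_strict => //; exact: xT.
split; first by apply/cellP => //; exact: strict_below.
by apply/punctual_hilbP; exact: strict_nilpotent xT.
Qed.

(** The open subset of the Hilbert scheme on which the words of [T] give a basis;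
    it contains the cell of [T] as a closed subset. *)
Definition framed T : set H := [set q | frames (word_vec (val (repr q))) T].

Lemma framedP T (x : stab) :
  framed T (hilb_class x) <-> frames (word_vec (val x)) T.
Proof.
have /hilb_classP[g [gb xE]] : hilb_class (repr (hilb_class x) : stab) = hilb_class x.
  exact: hilb_class_repr.
have /esym/hilb_classP[h [hb rE]] :
    hilb_class (repr (hilb_class x) : stab) = hilb_class x.
  exact: hilb_class_repr.
split=> xT; first by rewrite xE; exact: frames_gl.
by rewrite /framed /= rE; exact: frames_gl.
Qed.

End HilbertCells.

(** * Structure coefficients as regular functions *)
Section TreeCoordinates.
Variables (K : fieldType) (m : nat) (V : vectType K) (T : {fset word m}).
Variable e : word m -> V.
Hypothesis eT : frames e T.
Implicit Types (x : pairs K m V) (w : word m) (k : 'I_m).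

Local Notation H := (hilb K m V).
Local Notation stab := (subvariety (stable K m V)).
Local Notation n := (size (enum_fset T)).

Definition tree_tuple (v : word m -> V) : n.-tuple V :=
  map_tuple v (in_tuple (enum_fset T)).

Local Notation E := (tree_tuple e).
Let wd (i : 'I_n) : word m := nth [::] (enum_fset T) i.

Lemma tree_tuple_nth v (i : 'I_n) : (tree_tuple v)`_i = v (wd i).
Proof. exact: nth_map. Qed.

Lemma regular_coord_word_vec (U : set (affine (pairs K m V))) i w :
  open U ->
  @regular _ (affine (pairs K m V)) U (fun x => coord E i (word_vec x w)).
Proof.
move=> oU; elim/last_ind: w i => [|w k IHw] i.
  by apply: regular_scalar => // a x y; rewrite linearP.
apply: (@regular_ext _ _ _ (fun x : affine (pairs K m V) =>
    \sum_j coord E j (word_vec x w) * coord E i ((x : pairs K m V).1 k E`_j))).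
  move=> x _; rewrite word_vec_rcons [in RHS](@basis_coord _ _ _ E (word_vec x w) eT).
  by rewrite !linear_sum; apply: eq_bigr => j _; rewrite !linearZ.
apply: regular_sum => // j _; apply: regularM => //.
by apply: regular_scalar => // a x y; rewrite /= ffunE lfunE /= ffunE lfunE /= linearP.
Qed.

Definition tree_det x := \det (coord_mx E (tree_tuple (word_vec x))).

Lemma frames_det x : frames (word_vec x) T = (tree_det x != 0).
Proof.
rewrite -(@free_det _ _ _ E (tree_tuple (word_vec x)) eT).
apply/idP/idP => [/basis_free //|xf]; apply: basis_free_size => //.
by rewrite size_map; exact: frames_size eT.
Qed.

Lemma regular_coord_mx (U : set (affine (pairs K m V))) i j : open U ->
  @regular _ (affine (pairs K m V)) U
    (fun x => coord_mx E (tree_tuple (word_vec x)) i j).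
Proof.
move=> oU; apply: regular_ext (regular_coord_word_vec j (wd i) oU) => x _.
by rewrite mxE tree_tuple_nth.
Qed.

Definition frame_locus : set (affine (pairs K m V)) :=
  [set x | frames (word_vec x) T].

Lemma frame_locusE : frame_locus = setT `&` [set x | tree_det x != 0].
Proof. by rewrite setTI; apply/seteqP; split=> x;
  rewrite /frame_locus /= frames_det. Qed.

Lemma frame_locus_inverses :
  open frame_locus /\
  @regular _ (affine (pairs K m V)) frame_locus (fun x => (tree_det x)^-1).
Proof.
rewrite frame_locusE; apply: affine_has_inverses; first exact: openT.
by apply: regular_det => [|i j]; [exact: openT|apply: regular_coord_mx; exact: openT].
Qed.

(** Invariant under the group, so these functions descend to the Hilbert scheme. *)
Definition tree_coef j w x : K := coord (tree_tuple (word_vec x)) j (word_vec x w).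

Lemma regular_tree_coef j w :
  @regular _ (affine (pairs K m V)) frame_locus (tree_coef j w).
Proof.
have [oF rF] := frame_locus_inverses.
apply: (@regular_ext _ (affine (pairs K m V)) _
  (fun x => \sum_l coord E l (word_vec x w) *
    (\adj (coord_mx E (tree_tuple (word_vec x)))) l j * (tree_det x)^-1)).
  move=> x xF; rewrite /tree_coef.
  by rewrite (@coord_cramer _ _ _ E (tree_tuple (word_vec x)) _ _ eT xF).
apply: regular_sum => // l _; apply: regularM => //; apply: regularM => //.
  exact: regular_coord_word_vec.
by apply: regular_adj => // i i'; exact: regular_coord_mx.
Qed.

Lemma tree_coef_gl j w (g : 'End(V)) x : bijective g -> frames (word_vec x) T ->
  tree_coef j w (gl_act g x) = tree_coef j w x.
Proof.
move=> gb xT; rewrite /tree_coef word_vec_gl //.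
rewrite -(@coord_map_inj _ _ _ (tree_tuple (word_vec x)) g j _ (bij_inj gb) xT).
congr (coord _ _ _).
apply: val_inj; rewrite /= -map_comp; apply: eq_map => u.
exact: word_vec_gl.
Qed.

Lemma framed_open : open (framed T : set H).
Proof.
suff : open (hilb_class (K := K) (m := m) (V := V) @^-1` framed T) by [].
rewrite (_ : _ @^-1` _ = (val : stab -> affine (pairs K m V)) @^-1` frame_locus).
  exact/open_subvariety/frame_locus_inverses.1.
apply/seteqP; split=> x xT; first exact: (proj1 (framedP T x) xT).
exact: (proj2 (framedP T x) xT).
Qed.

Lemma regular_framed_coef j w :
  @regular _ H (framed T) (fun q => tree_coef j w (val (repr q : stab))).
Proof.
move=> x xT; exists frame_locus, (tree_coef j w).
have [oF _] := frame_locus_inverses.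
split; [exact: oF|exact: (proj1 (framedP T x) xT)|exact: regular_tree_coef|].
move=> y yT; split; first exact: (proj2 (framedP T y) yT).
have /esym/hilb_classP[h [hb rE]] :
    hilb_class (repr (hilb_class y) : stab) = hilb_class y.
  exact: hilb_class_repr.
by rewrite /= [X in tree_coef j w X]rE tree_coef_gl.
Qed.

End TreeCoordinates.

(** * The affine chart of a punctual cell *)
Section Chart.
Variables (K : fieldType) (m : nat) (V : vectType K) (T : {fset word m}).
Variable e : word m -> V.
Hypothesis tT : is_tree T.
Hypothesis eT : frames e T.
Implicit Types (x : pairs K m V) (w : word m) (k : 'I_m).

Local Notation H := (hilb K m V).
Local Notation stab := (subvariety (stable K m V)).
Local Notation n := (size (enum_fset T)).
Local Notation E := (tree_tuple T e).
Let wd (i : 'I_n) : word m := nth [::] (enum_fset T) i.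

Let wdT i : wd i \in T. Proof. exact: mem_nth. Qed.

Let wdP w : w \in T -> exists i, w = wd i.
Proof.
move=> wT; have wn : (index w (enum_fset T) < n)%N by rewrite index_mem.
by exists (Ordinal wn); rewrite /wd /= nth_index.
Qed.

(** The free coordinates: [(i, k, j)] stands for the coefficient at the word number
    [j] in the image under letter [k] of the vector of the word number [i]. *)
Definition slots : {set 'I_n * 'I_m * 'I_n} :=
  [set t | (rcons (wd t.1.1) t.1.2 \notin T) && lex_strict (wd t.1.1) t.1.2 (wd t.2)].

Local Notation N := #|slots|.
Let slot (a : 'I_N) : 'I_n * 'I_m * 'I_n := enum_val a.

Let slotP a : (rcons (wd (slot a).1.1) (slot a).1.2 \notin T) /\
  lex_strict (wd (slot a).1.1) (slot a).1.2 (wd (slot a).2).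
Proof. by have := enum_valP a; rewrite inE => /andP. Qed.

(** The tuple in normal form all of whose free coefficients vanish. *)
Definition chart_base : pairs K m V :=
  ([ffun k => basis_map E (fun i =>
      if rcons (wd i) k \in T then e (rcons (wd i) k) else 0)], e [::]).

Definition chart_dir (a : 'I_N) : pairs K m V :=
  ([ffun k => if k == (slot a).1.2 then
      basis_map E (fun i => if i == (slot a).1.1 then e (wd (slot a).2) else 0)
    else 0], 0).

Definition chart_point (c : 'rV[K]_N) : pairs K m V :=
  chart_base + \sum_a c 0 a *: chart_dir a.

Let basis_map_wd (Y : 'I_n -> V) i : basis_map E Y (e (wd i)) = Y i.
Proof. by rewrite -(tree_tuple_nth e i) basis_map_nth //; exact: basis_free eT. Qed.

Let coord_wd i j : coord E j (e (wd i)) = (i == j)%:R.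
Proof. by rewrite -(tree_tuple_nth e i) coord_free //; exact: basis_free eT. Qed.

Lemma chart_point2 c : (chart_point c).2 = e [::].
Proof.
rewrite /chart_point /= raddf_sum big1 ?addr0 // => a _.
by rewrite /= scaler0.
Qed.

Lemma chart_point1 c k i : (chart_point c).1 k (e (wd i)) =
  (if rcons (wd i) k \in T then e (rcons (wd i) k) else 0) +
  \sum_(a | (slot a).1 == (i, k)) c 0 a *: e (wd (slot a).2).
Proof.
rewrite /chart_point /= raddf_sum ffunE lfunE /= ffunE basis_map_wd; congr (_ + _).
rewrite sum_ffunE sum_lfunE [RHS]big_mkcond; apply: eq_bigr => a _.
rewrite /= ffunE lfunE /= ffunE [_ == (i, k)]xpair_eqE andbC.
case: (eqVneq k) => _ /=; last by rewrite lfunE /= scaler0.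
by rewrite basis_map_wd; case: (eqVneq i) => //= _; rewrite scaler0.
Qed.

Lemma chart_point_word_vec c : {in T, word_vec (chart_point c) =1 e}.
Proof.
move=> w; elim/last_ind: w => [|w k IHw] wkT; first exact: chart_point2.
have wT : w \in T by apply: tT wkT; exact: prefix_rcons.
rewrite word_vec_rcons IHw //; have [i wE] := wdP wT.
rewrite wE chart_point1 -wE wkT big1 ?addr0 // => a /eqP aE.
by have [] := slotP a; rewrite aE /= -wE wkT.
Qed.

Lemma chart_point_rcons c i k : rcons (wd i) k \notin T ->
  word_vec (chart_point c) (rcons (wd i) k) =
  \sum_(a | (slot a).1 == (i, k)) c 0 a *: e (wd (slot a).2).
Proof.
move=> /negPf ikT.
by rewrite word_vec_rcons chart_point_word_vec // chart_point1 ikT add0r.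
Qed.

Lemma chart_point_staircase c : staircase (@lex_strict m) T (chart_point c).
Proof.
have cE := @chart_point_word_vec c.
split=> [|w k wT]; first by rewrite /frames (proj1 (eq_in_map _ e _) cE).
have [i ->] := wdP wT => ikT; rewrite chart_point_rcons // (eq_tree_span _ cE).
apply: memv_suml => a /eqP aE; apply: memvZ; apply: mem_tree_span => //.
by have [_] := slotP a; rewrite aE.
Qed.

Lemma coord_tree_span P j u :
  u \in tree_span e T P -> ~~ P (wd j) -> coord E j u = 0.
Proof.
move=> uP Pj; pose l : {linear V -> K^o} := coord E j.
suff /subvP/(_ _ uP) : (tree_span e T P <= lker (linfun l))%VS.
  by rewrite memv_ker lfunE => /eqP.
apply: tree_span_sub => w wT Pw; have [i wE] := wdP wT.
rewrite memv_ker lfunE /l /= wE coord_wd.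
by case: (eqVneq i j) Pj => // <-; rewrite -wE Pw.
Qed.

Lemma chart_point_coord c i k j : rcons (wd i) k \notin T ->
  coord E j (word_vec (chart_point c) (rcons (wd i) k)) =
  \sum_(a | slot a == (i, k, j)) c 0 a.
Proof.
move=> ikT; rewrite chart_point_rcons // linear_sum [LHS]big_mkcond [RHS]big_mkcond.
apply: eq_bigr => a _; rewrite [slot a == _]xpair_eqE; case: ifP => //= _.
rewrite linearZ /= coord_wd.
by case: eqVneq => _; rewrite ?mulr1 ?mulr0.
Qed.

Definition chart_coord (q : H) : 'rV[K]_N :=
  \row_a tree_coef (slot a).2 (rcons (wd (slot a).1.1) (slot a).1.2)
    (val (repr q : stab)).

Lemma chart_point_coef c a :
  tree_coef (slot a).2 (rcons (wd (slot a).1.1) (slot a).1.2) (chart_point c) = c 0 a.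
Proof.
have [aT _] := slotP a; rewrite /tree_coef.
have -> : tree_tuple T (word_vec (chart_point c)) = E.
  by apply: val_inj; exact: (proj1 (eq_in_map _ e _) (chart_point_word_vec c)).
rewrite chart_point_coord // (big_pred1 a) // => b.
rewrite -!surjective_pairing; exact: (inj_eq enum_val_inj).
Qed.

(** A tuple whose tree vectors are the basis [e] is determined by the images of
    basis vectors leaving the tree, and the staircase condition kills their
    coordinates outside [slots]. *)
Lemma chart_point_normal x : staircase (@lex_strict m) T x ->
  {in T, word_vec x =1 e} ->
  chart_point (\row_a tree_coef (slot a).2 (rcons (wd (slot a).1.1) (slot a).1.2) x) = x.
Proof.
move=> [xT xP] xe; set c := \row_a _.
have Xe : tree_tuple T (word_vec x) = E.
  by apply: val_inj; exact: (proj1 (eq_in_map _ e _) xe).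
have c2 : (chart_point c).2 = x.2.
  rewrite chart_point2; have [T0|T0] := boolP ([::] \in T); first by rewrite -xe.
  by rewrite [LHS](frames_no_root _ tT xT T0) [RHS](frames_no_root _ tT xT T0).
suff c1 : (chart_point c).1 = x.1.
  by rewrite [LHS]surjective_pairing c1 c2 -surjective_pairing.
apply/ffunP => k; apply: (basis_lfunP eT) => _ /mapP[w wT ->].
have [i wE] := wdP wT.
rewrite -{1}(chart_point_word_vec c wT) -(xe w wT) -!word_vec_rcons.
have [wkT|wkT] := boolP (rcons w k \in T).
  by rewrite chart_point_word_vec // xe.
apply: (@coord_inj _ _ _ E _ _ eT) => j.
rewrite wE in wT wkT *; rewrite chart_point_coord //.
have [ijk|ijk] := boolP ((i, k, j) \in slots).
  rewrite (big_pred1 (enum_rank_in ijk (i, k, j))) => [|a]; last first.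
    rewrite -[X in slot a == X](enum_rankK_in ijk ijk).
    exact: (inj_eq enum_val_inj).
  by rewrite mxE /slot enum_rankK_in // /tree_coef Xe.
rewrite big_pred0 => [|a]; last first.
  by apply: contraNF ijk => /eqP <-; exact: enum_valP.
apply/esym/coord_tree_span; last by move: ijk; rewrite inE /= wkT; exact.
by have := xP _ _ wT wkT; rewrite (eq_tree_span _ xe).
Qed.

Let C : set H := cell T e `&` punctual_hilb K m V.

Let chart_stable c : chart_point c \in stable K m V.
Proof. by apply/mem_set/frames_stable; exact: (chart_point_staircase c).1. Qed.

Definition chart_stab c : stab :=
  exist (fun z => z \in stable K m V) _ (chart_stable c).

Let chart_cell c : hilb_class (chart_stab c) \in C.
Proof.
by apply/mem_set/(proj2 (cell_punctualP _ tT eT)); exact: chart_point_staircase.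
Qed.

Definition chart_map (c : affine 'rV[K]_N) : subvariety C :=
  exist (fun z => z \in C) _ (chart_cell c).

Definition chart_inv (q : subvariety C) : affine 'rV[K]_N := chart_coord (val q).

Lemma chart_coord_class (y : stab) : frames (word_vec (val y)) T ->
  chart_coord (hilb_class y) =
  \row_a tree_coef (slot a).2 (rcons (wd (slot a).1.1) (slot a).1.2) (val y).
Proof.
move=> yT; have /esym/hilb_classP[h [hb rE]] :
    hilb_class (repr (hilb_class y) : stab) = hilb_class y.
  exact: hilb_class_repr.
by apply/rowP => a; rewrite !mxE [X in tree_coef _ _ X]rE tree_coef_gl.
Qed.

Lemma chart_mapK : cancel chart_map chart_inv.
Proof.
move=> c; rewrite /chart_inv /= chart_coord_class; last first.
  exact: (chart_point_staircase c).1.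
by apply/rowP => a; rewrite mxE chart_point_coef.
Qed.

Lemma chart_invK : cancel chart_inv chart_map.
Proof.
suff class_chart q : C q -> hilb_class (chart_stab (chart_coord q)) = q.
  by move=> q; apply: val_inj; apply: class_chart; exact: set_mem (valP q).
rewrite -(hilb_class_repr q).
move: (repr q : stab) => {q} x /(proj1 (cell_punctualP _ tT eT)) xT.
apply/esym/hilb_classP.
have [g gb gE] := normal_form xT.1 eT; exists g; split=> //.
rewrite /= chart_coord_class; last exact: xT.1.
rewrite -[RHS](chart_point_normal (staircase_gl gb xT) gE); congr chart_point.
by apply/rowP => a; rewrite !mxE tree_coef_gl //; exact: xT.1.
Qed.

Lemma hilb_has_inverses : has_inverses H.
Proof.
exact/quotient_has_inverses/subvariety_has_inverses/affine_has_inverses.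
Qed.

(** The coordinates of a cell are restrictions of functions regular on the open set
    [framed T]. *)
Lemma chart_inv_morphism : is_morphism chart_inv.
Proof.
apply: affine_morphism; first exact/subvariety_has_inverses/hilb_has_inverses.
move=> i; have oT : open (setT : set (subvariety C)) by exact: openT.
apply: (@regular_ext _ (subvariety C) _ (fun q => \sum_a chart_inv q 0 a *
    coord (vbasis {:'rV[K]_N}) i (delta_mx 0 a))).
  move=> q _; rewrite [X in _ = coord _ _ X]row_sum_delta linear_sum.
  by apply: eq_bigr => a _; rewrite linearZ.
apply: regular_sum => // a _; apply: regularM => //; last exact: regular_cst.
move=> q _; exists (framed T), (fun q => tree_coef (slot a).2
  (rcons (wd (slot a).1.1) (slot a).1.2) (val (repr q : stab))); split.
- exact: framed_open eT.
- have qC : C (val q) by exact: set_mem (valP q).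
  move: (val q : H) qC => {}q; rewrite -(hilb_class_repr q).
  move=> /(proj1 (cell_punctualP _ tT eT)) xT; apply: (proj2 (framedP _ _)).
  exact: xT.1.
- exact: regular_framed_coef eT _ _.
- by move=> r _; rewrite /chart_inv mxE.
Qed.

Lemma chart_map_morphism : is_morphism chart_map.
Proof.
apply: subvariety_morphism.
suff stabM : @is_morphism K (affine 'rV[K]_N) stab chart_stab.
  exact: (morphism_comp stabM (quot_proj_morphism _)).
apply: subvariety_morphism; apply: affine_morphism; first exact: affine_has_inverses.
move=> i; have oT : open (setT : set (affine 'rV[K]_N)) by exact: openT.
pose l := coord (vbasis {:pairs K m V}) i.
apply: (@regular_ext _ (affine 'rV[K]_N) _
  (fun c => l chart_base + \sum_a (c : 'rV[K]_N) 0 a * l (chart_dir a))).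
  move=> c _; rewrite /= /chart_point linearD linear_sum; congr (_ + _).
  by apply: eq_bigr => a _; rewrite linearZ.
apply: regularD => //; first exact: regular_cst.
apply: regular_sum => // a _; apply: regularM => //; last exact: regular_cst.
by apply: regular_scalar => // b u v; rewrite !mxE.
Qed.

Lemma cell_punctual_affine : is_affine_space (subvariety C).
Proof.
exists N, chart_inv, chart_map; split.
- exact: chart_invK.
- exact: chart_mapK.
- exact: chart_inv_morphism.
- exact: chart_map_morphism.
Qed.

End Chart.

(** * The paving *)
Section Paving.
Variables (K : fieldType) (m : nat) (V : vectType K).
Variable e : {fset word m} -> word m -> V.
Hypothesis eP : forall T, trees m (\dim {:V}) T -> frames (e T) T.
Implicit Types (T : {fset word m}).

Local Notation H := (hilb K m V).
Local Notation stab := (subvariety (stable K m V)).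
Local Notation P := (punctual_hilb K m V).
Local Notation D := (trees m (\dim {:V})).

Lemma hilb_cell_cover (q : H) : exists2 T, D T & cell T (e T) q.
Proof.
rewrite -(hilb_class_repr q); set x : stab := repr q.
have [T tT xT] := depth_first_tree (set_mem (valP x)).
by exists T => //; apply: (proj2 (cellP _ tT.1 (eP tT))).
Qed.

Lemma cell_framed T (q : H) : D T -> cell T (e T) q -> framed T q.
Proof.
move=> tT; rewrite -(hilb_class_repr q).
by move=> /(proj1 (cellP _ tT.1 (eP tT)))[xT _]; apply: (proj2 (framedP _ _)).
Qed.

Lemma cell_key_min T T' (q : H) : D T -> D T' -> cell T (e T) q ->
  framed T' q -> (tree_key T <= tree_key T')%O.
Proof.
move=> tT tT'; rewrite -(hilb_class_repr q).
move=> /(proj1 (cellP _ tT.1 (eP tT))) xT /(proj1 (framedP _ _)) xT'.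
by apply: staircase_key_le xT xT'; [exact: tT.1|exact: tT'.1|rewrite tT.2 tT'.2].
Qed.

Lemma cell_inj T T' (q : H) : D T -> D T' ->
  cell T (e T) q -> cell T' (e T') q -> T = T'.
Proof.
move=> tT tT' qT qT'; apply: tree_key_inj; apply: le_anti.
by rewrite !(@cell_key_min _ _ q) //; exact: cell_framed.
Qed.

(** A point lies in the cell of the least tree that frames it, so a cell is an open
    set minus the open sets belonging to smaller trees. *)
Lemma cellE T : D T -> cell T (e T) =
  framed T `&`
  ~` \bigcup_(T' in [set T' | D T' /\ (tree_key T' < tree_key T)%O]) framed T'.
Proof.
move=> tT; apply/seteqP; split=> q.
  move=> qT; split; first exact: cell_framed qT.
  move=> [T' [tT' lt'] qT'].
  by have := cell_key_min tT tT' qT qT'; rewrite leNgt lt'.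
move=> [qT nq]; have [T0 tT0 qT0] := hilb_cell_cover q.
have := cell_key_min tT0 tT qT0 qT; rewrite le_eqVlt => /orP[/eqP/tree_key_inj <- //|lt0].
by case: nq; exists T0 => //; exact: cell_framed qT0.
Qed.

Lemma trees_framed_open T : D T -> open (framed T : set H).
Proof. by move=> /eP; exact: framed_open. Qed.

Lemma cell_locally_closed T : D T -> locally_closed (cell T (e T) : set H).
Proof.
move=> tT; exists (framed T),
  (~` \bigcup_(T' in [set T' | D T' /\ (tree_key T' < tree_key T)%O]) framed T').
split; [exact: trees_framed_open| |exact: cellE].
by apply: open_closedC; apply: bigcup_open => T' [tT' _]; exact: trees_framed_open.
Qed.

(** Listing the trees in decreasing order, the union of the first cells is the set
    of points framed by none of the remaining trees. *)
Lemma cell_segment_closed (s : seq {fset word m}) k : [set` s] = D ->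
  sorted (fun T T' => tree_key T' < tree_key T)%O s ->
  closed (\bigcup_(T in [set` take k s]) cell T (e T) : set H).
Proof.
move=> sD ss; have Ds T : T \in s <-> D T.
  by have /(congr1 (fun A : set _ => A T)) /= := sD; move=> ->.
rewrite (_ : \bigcup_(T in _) _ = ~` \bigcup_(T in [set` drop k s]) framed T).
  apply: open_closedC; apply: bigcup_open => T /= Tk; apply: trees_framed_open.
  by apply/Ds; exact: mem_drop Tk.
apply/seteqP; split=> q.
  move=> [T0 /= T0k qT0] [T /= Tk qT].
  have tT0 : D T0 by apply/Ds; exact: mem_take T0k.
  have tT : D T by apply/Ds; exact: mem_drop Tk.
  have := cell_key_min tT0 tT qT0 qT; rewrite leNgt.
  move: ss; rewrite sorted_pairwise; last by move=> ? ? ? h /lt_trans; exact.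
  rewrite -{1}(cat_take_drop k s) pairwise_cat => /and3P[/allrelP/(_ _ _ T0k Tk) + _ _].
  by move=> ->.
move=> nq; have [T0 tT0 qT0] := hilb_cell_cover q.
exists T0 => //=; have /Ds := tT0; rewrite -{1}(cat_take_drop k s) mem_cat.
by case/orP => // T0k; case: nq; exists T0 => //; exact: cell_framed qT0.
Qed.

Lemma punctual_paving : is_affine_paving (X := subvariety P) D
  (fun T => val @^-1` cell T (e T)).
Proof.
have vP : continuous (val : subvariety P -> H) := (subvariety_val_morphism P).1.
split.
- apply/seteqP; split=> // q _; have [T tT qT] := hilb_cell_cover (val q).
  by exists T.
- by move=> T T' tT tT' [q [qT qT']]; exact: (cell_inj tT tT' qT qT').
- move=> T tT; split.
    have [U [F [oU cF ->]]] := cell_locally_closed tT.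
    exists (val @^-1` U), (val @^-1` F); split=> //; first exact: open_subvariety.
    by apply: preimage_closed cF => q _; exact: vP.
  have [N cN] := cell_punctual_affine tT.1 (eP tT).
  by exists N; apply: isomorphic_trans cN; exact: subvariety_preimage_isomorphic.
- have [s [us sD ss]] := trees_enum m (\dim {:V}).
  exists s; split=> // k.
  rewrite -preimage_bigcup; apply: preimage_closed => [q _|]; first exact: vP.
  exact: cell_segment_closed.
Qed.

End Paving.

Theorem theorem5p1 (R : realType) (m d : nat) (V : vectType R[i])
    (e : {fset word m} -> word m -> V) :
  (0 < m)%N ->
  \dim {:V} = d ->
  (forall T : {fset word m}, trees m d T ->
     basis_of {:V} [seq e T w | w <- enum_fset T]) ->
  (forall T : {fset word m}, trees m d T ->
     is_affine_space (subvariety (cell T (e T) `&` punctual_hilb R[i] m V)))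
  /\ is_affine_paving (X := subvariety (punctual_hilb R[i] m V)) (trees m d)
       (fun T => val @^-1` cell T (e T)).
Proof.
move=> _ <- eP; split; last exact: punctual_paving.
by move=> T tT; exact: cell_punctual_affine tT.1 (eP T tT).
Qed.
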